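(* Let $\mathbf{k}$ be an algebraically closed field of characteristic $0$, let $U$ be a $\mathbf{k}$-vector space of dimension $2$, let $\lambda$ be a partition of $d\ge 1$, let $B=\bigoplus_{m\ge 0}\operatorname{Sym}^d(\operatorname{Sym}^m U)$, and let $M_\lambda=\bigoplus_{m\ge 0}\mathbf{S}_\lambda(\operatorname{Sym}^m U)$ be the $B$-module of $\lambda$-covariants. Then, as a $B$-module, $M_\lambda$ has one minimal generator for every standard Young tableau $T$ of shape $\lambda$, and the generator corresponding to $T$ lies in degree $\mathrm{des}(T)$. Furthermore, for every $i$, $$\operatorname{ch}\left(\operatorname{Tor}_0^B(M_\lambda,\mathbf{k})_i\right)=\sum_{\substack{T\in\mathrm{SYT}(\lambda)\\ \mathrm{des}(T)=i}}q^{\mathrm{maj}(T)}.$$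
   Context: Let $A=\bigoplus_{m\ge 0}(\operatorname{Sym}^m U)^{\otimes d}$ ($d$ tensor factors), a subring of $\operatorname{Sym}(U)^{\otimes d}$ graded by $m$, with $\mathfrak{S}_d$ acting by permuting tensor factors. Then $B=A^{\mathfrak{S}_d}=\bigoplus_{m\ge 0}\operatorname{Sym}^d(\operatorname{Sym}^m U)$ (characteristic zero identifies symmetric tensors with symmetric powers), and $M_\lambda=\operatorname{Hom}_{\mathfrak{S}_d}(V_\lambda,A)=\bigoplus_{m\ge0}\mathbf{S}_\lambda(\operatorname{Sym}^mU)$, where $V_\lambda$ is the irreducible $\mathfrak{S}_d$-representation indexed by $\lambda$ ($V_{(d)}$ trivial, $V_{(1^d)}$ sign) and $\mathbf{S}_\lambda$ is the Schur functor. It is a graded $B$-module, graded by $m$. The degree $i$ part $\operatorname{Tor}_0^B(M_\lambda,\mathbf{k})_i$ is a polynomial $\mathbf{GL}(U)$-representation of degree $di$. For a polynomial $\mathbf{GL}(U)$-representation $L$ of degree $k$ with $\dim U=2$, let $L=\bigoplus_{a+b=k}L_{a,b}$ be the weight decomposition for the maximal torus $(\mathbf{k}^* )^2$, where $(t_1,t_2)$ acts on $L_{a,b}$ by $t_1^at_2^b$; its character is $\operatorname{ch}(L)=\sum_{a=0}^k\dim(L_{a,k-a})q^a\in\mathbb{Z}[q]$. $\mathrm{SYT}(\lambda)$ is the set of standard Young tableaux of shape $\lambda$ (fillings of the Young diagram with $1,\dots,d$, each used once, increasing along rows and down columns; the diagram has $\lambda_i$ boxes in row $i$, with row $1$ at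 the top). $T\in\mathrm{SYT}(\lambda)$ has a descent at $j$ if $j+1$ appears in a lower row than $j$; $\mathrm{des}(T)$ is the number of descents of $T$ and $\mathrm{maj}(T)$ is the sum of the descents of $T$. *)

(* Defs.v *)
From HB Require Import structures.
From mathcomp Require Import all_boot all_order all_algebra all_fingroup.
From mathcomp Require Import all_character.
From mathcomp Require Import mpoly.

Set Implicit Arguments.
Unset Strict Implicit.
Unset Printing Implicit Defensive.

Import GRing.Theory.
Local Open Scope ring_scope.

(* Partitions are weakly decreasing sequences of positive integers.  The
   boxes of the diagram of la are numbered by 'I_d in reading order: left to
   right in the top row, then in the next row, and so on. *)

Definition is_partition (d : nat) (la : seq nat) : bool :=
  [&& sorted geq la, 0%N \notin la & sumn la == d].

Section Tableaux.
Variables (d : nat) (la : seq nat).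

Definition box_row (c : 'I_d) : nat := reshape_index la c.
Definition box_col (c : 'I_d) : nat := reshape_offset la c.

(* A filling by 1, ..., d is encoded by T : 'S_d, the box c containing the
   entry (T c).+1. *)
Definition entry (T : 'S_d) (c : 'I_d) : nat := (T c).+1.

Definition is_standard (T : 'S_d) : bool :=
  [forall c1, forall c2,
     ((box_row c1 == box_row c2) && (box_col c1 < box_col c2)%N
        ==> (entry T c1 < entry T c2)%N) &&
     ((box_col c1 == box_col c2) && (box_row c1 < box_row c2)%N
        ==> (entry T c1 < entry T c2)%N)].

Record SYT := Syt { syt_perm :> 'S_d; _ : is_standard syt_perm }.

HB.instance Definition _ := [isSub for syt_perm].
HB.instance Definition _ := [Finite of SYT by <:].

Definition descent (T : 'S_d) (j : nat) : bool :=
  [exists c1, exists c2,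
     [&& entry T c1 == j, entry T c2 == j.+1 & (box_row c1 < box_row c2)%N]].

Definition des (T : SYT) : nat := (\sum_(1 <= j < d | descent T j) 1)%N.
Definition maj (T : SYT) : nat := (\sum_(1 <= j < d | descent T j) j)%N.

End Tableaux.

(* V_la is generated by the Young symmetrizer c_la in the group algebra.  In
   MathComp permutations multiply left to right and representations act on
   row vectors from the right, so V_la is the right ideal c_la k[S_d]; the
   group algebra is the space of the regular representation. *)

Section Specht.
Variables (k : fieldType) (d : nat) (la : seq nat).

Definition row_stab : {set 'S_d} :=
  [set s : 'S_d | [forall c, box_row la (s c) == box_row la c]].
Definition col_stab : {set 'S_d} :=
  [set s : 'S_d | [forall c, box_col la (s c) == box_col la c]].

Definition young_symmetrizer : 'rV[k]_#|[set: 'S_d]| :=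
  \sum_(p in row_stab) \sum_(q in col_stab)
     (-1) ^+ q *: delta_mx 0 (gring_index [set: 'S_d] (p * q)%g).

Definition specht_mx : 'M[k]_#|[set: 'S_d]| :=
  cyclic_mx (regular_repr k [set: 'S_d]) young_symmetrizer.

Definition specht_dim : nat := \rank specht_mx.

Definition specht_repr : mx_representation k [set: 'S_d] specht_dim :=
  submod_repr (cyclic_mx_module (regular_repr k [set: 'S_d]) young_symmetrizer).

End Specht.

(* U = k^2, so that Sym(U)^{(x) d} is the polynomial ring in the entries of
   the generic d x 2 matrix genmx; row i holds the basis of U in the i-th
   tensor factor. *)

Section SegreRing.
Variables (k : fieldType) (d : nat).

Definition SymUd := {mpoly k[d * 2]}.

Definition genmx : 'M[SymUd]_(d, 2) := \matrix_(i, j) 'X_(mxvec_index i j).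

(* The k-algebra endomorphism of SymUd sending genmx to Q. *)
Definition subst (Q : 'M[SymUd]_(d, 2)) (p : SymUd) : SymUd :=
  p \mPo [tuple mxvec Q 0 x | x < d * 2].

(* Moves the factor i to the factor s i; a right action, as for V_la. *)
Definition perm_act (s : 'S_d) : SymUd -> SymUd := subst (row_perm s genmx).

(* Induced by the action e_j |-> \sum_b g b j e_b of GL(U) on U. *)
Definition gl_act (g : 'M[k]_2) : SymUd -> SymUd :=
  subst (genmx *m map_mx (mpolyC (d * 2) (R := k)) g).

Definition factor_deg (i : 'I_d) (mon : 'X_{1..d * 2}) : nat :=
  (\sum_(j < 2) mon (mxvec_index i j))%N.

Definition A_deg (m : nat) (p : SymUd) : Prop :=
  forall mon, mon \in msupp p -> forall i, factor_deg i mon = m.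

Definition A_ring (p : SymUd) : Prop :=
  exists n (f : nat -> SymUd),
    (forall m, A_deg m (f m)) /\ p = \sum_(m < n) f m.

Definition B_ring (p : SymUd) : Prop :=
  A_ring p /\ forall s, perm_act s p = p.

(* The kernel of the augmentation B -> k, that is, the sum of the parts of
   positive degree. *)
Definition B_plus (p : SymUd) : Prop := B_ring p /\ p@_0%MM = 0.

End SegreRing.

(* A linear map phi : V_la -> A is recorded by the column of the images of
   the basis vectors of V_la; the B-module structure is then the scaling of
   columns by polynomials. *)

Section Covariants.
Variables (k : fieldType) (d : nat) (la : seq nat).

Notation R := (SymUd k d).
Definition covector := 'cV[R]_(specht_dim k d la).

Definition equivariant (phi : covector) : Prop :=
  forall s : 'S_d,
    map_mx (perm_act s) phi =
    map_mx (mpolyC (d * 2) (R := k)) (specht_repr k d la s) *m phi.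

Definition M_mod (phi : covector) : Prop :=
  equivariant phi /\ forall x, A_ring (phi x 0).

Definition M_deg (m : nat) (phi : covector) : Prop :=
  equivariant phi /\ forall x, A_deg m (phi x 0).

Definition B_span (I : finType) (P : pred I) (g : I -> covector)
    (phi : covector) : Prop :=
  exists b : I -> R,
    (forall x, B_ring (b x)) /\ phi = \sum_(x | P x) b x *: g x.

Definition minimal_generators (I : finType) (g : I -> covector) : Prop :=
  [/\ forall x, M_mod (g x),
      forall phi, M_mod phi -> B_span predT g phi &
      forall x, ~ (forall phi, M_mod phi -> B_span (predC1 x) g phi)].

(* The submodule B_+ M; Tor_0^B(M, k) = M (x)_B k is the quotient
   M / B_+ M, and its degree i part is the image of M_i. *)
Definition BplusM (phi : covector) : Prop :=
  exists n (b : 'I_n -> R) (m : 'I_n -> covector),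
    (forall x, B_plus (b x) /\ M_mod (m x)) /\ phi = \sum_x b x *: m x.

(* A subspace of Tor_0^B(M, k) is given by its preimage W in M; it has
   dimension n when there is a k-basis of W modulo B_+ M of size n. *)
Definition tor_subspace_dim (W : covector -> Prop) (n : nat) : Prop :=
  exists w : 'I_n -> covector,
    [/\ forall x, W (w x),
        forall v, W v ->
          exists c : 'I_n -> k, BplusM (v - \sum_x (c x)%:MP *: w x) &
        forall c : 'I_n -> k,
          BplusM (\sum_x (c x)%:MP *: w x) -> forall x, c x = 0].

(* Elements of M_i whose class in Tor_0^B(M, k)_i has weight (a, b) for the
   diagonal torus of GL(U). *)
Definition tor_weight (i a b : nat) (phi : covector) : Prop :=
  M_deg i phi /\
  forall t : 'rV[k]_2, (forall j, t 0 j != 0) ->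
    BplusM (map_mx (gl_act (diag_mx t)) phi
            - (t 0 0 ^+ a * t 0 1 ^+ b)%:MP *: phi).

(* p is the character of Tor_0^B(M, k)_i, which has degree d * i. *)
Definition is_tor_char (i : nat) (p : {poly int}) : Prop :=
  exists f : nat -> nat,
    (forall a, (a <= d * i)%N ->
       tor_subspace_dim (tor_weight i a (d * i - a)) (f a)) /\
    p = \poly_(a < (d * i).+1) (f a)%:R.

End Covariants.

(* Main.v *)
Require Import Defs.
From mathcomp Require Import all_boot all_order all_algebra all_fingroup.
From mathcomp Require Import all_character.
From mathcomp Require Import mpoly.
From mathcomp Require Import zify.

Set Implicit Arguments.
Unset Strict Implicit.
Unset Printing Implicit Defensive.

Import GRing.Theory.
Local Open Scope ring_scope.

(** The module of covariants is free over B, and an explicit basis is indexed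
    by the standard tableaux; everything else is read off from that basis.

    Maschke's averaging argument extends an equivariant map from the right
    ideal V_la = c k[S_d] to the whole group algebra, so every covariant is
    v |-> f.v for some f in A ([translate_average]), and it vanishes exactly
    when f.c = 0 ([translate_eq0]).  Thus M_la is identified with A c.  A
    monomial of degree m in A is prod_i x_i^(m - b_i) y_i^(b_i), that is, a
    filling b of the diagram with entries at most m, so A_m c is the Schur
    functor of the space with basis 0, ..., m.  Two facts are needed.

    (1) An element of A_m c whose coefficients vanish at all semistandard
        fillings is zero ([straightening], by Garnir relations).

    (2) Semistandard fillings correspond to pairs (T, mu) where T is a standard
        tableau and mu is a weakly increasing sequence: b = a_T + mu o T, where
        a_T(i) counts the descents of T below the entry of i
        ([standardization], [std_filling_inj]).

    The generator attached to T is the covariant of the monomial of a_T, which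
    has degree des T and weight (maj T, d des T - maj T).  Multiplying it by the
    S_d-orbit sum of the monomial of mu, which lies in B, gives another
    covariant.  Their coefficients at the semistandard fillings form a
    triangular matrix with nonzero diagonal, once fillings are ordered by an
    energy that grows, first, with the spread of the content and, second, with
    the entries in high rows ([energy_std_filling], [idx_matrix_tri],
    [idx_matrix_diag]).  By (1) these products span M_la
    ([covariant_generation]); since orbit sums span B, their independence says
    that the generators are free over B ([covariant_free]).

    Finally, sum_T b_T g_T lies in B_+ M_la iff all the constant terms of the
    b_T vanish, so the classes of the weight vectors g_T form a basis of
    Tor_0, which gives both minimality and the character. *)

(** * Rearrangements *)

Section Rearrangement.
Local Open Scope nat_scope.
Variables (X : finType) (Y : eqType) (blk : X -> Y) (al nu : X -> nat).
Hypothesis comono : forall x y, blk x = blk y -> al x < al y -> nu x <= nu y.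

Definition blk_perm (r : {perm X}) := forall x, blk (r x) = blk x.

(** [nu o r] and [nu] take each value equally often on a block, so a place
    where [nu] takes a value that [nu o r] does not is matched by a place where
    the converse happens. *)
Lemma disagreement_value (r : {perm X}) x : blk_perm r -> nu (r x) != nu x ->
  exists2 y, blk y = blk x & (nu (r y) == nu x) && (nu y != nu x).
Proof.
move=> br nx; pose S := [set z | (blk z == blk x) && (nu z == nu x)].
have S_r : #|r @^-1: S| = #|S| by rewrite card_preimset //; apply: perm_inj.
case: (boolP (r @^-1: S \subset S)) => [sub|/subsetPn[y]].
  have /eqP eS : r @^-1: S == S by rewrite eqEcard sub S_r leqnn.
  have : x \in S by rewrite inE !eqxx.
  by rewrite -{1}eS !inE (negbTE nx) andbF.
rewrite !inE br => /andP[/eqP by_ ny]; rewrite by_ eqxx /= => ny'.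
by exists y; rewrite // ny ny'.
Qed.

Lemma disagreement_value_inv (r : {perm X}) x : blk_perm r ->
  nu (r x) != nu x ->
  exists2 y, blk y = blk x & (nu y == nu (r x)) && (nu (r y) != nu (r x)).
Proof.
move=> br nx; have brV : blk_perm r^-1 by move=> z; rewrite -[in RHS](permKV r z) br.
have [|y by_ /andP[ny ny']] := @disagreement_value r^-1 (r x) brV.
  by rewrite permK eq_sym.
by exists (r^-1%g y); rewrite ?brV ?by_ ?br // ny permKV.
Qed.

(** The rearrangement inequality, applied block by block, with its equality
    case: an optimal rearrangement of [nu] differs from [nu] only by moves
    inside the level sets of [al].  The largest value of [nu] that is out of
    place is brought home by one transposition, which does not decrease the
    sum, and changes it unless the two places have the same [al]. *)
Lemma rearrangement (r : {perm X}) : blk_perm r ->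
  \sum_x al x * nu (r x) <= \sum_x al x * nu x /\
  (\sum_x al x * nu (r x) = \sum_x al x * nu x ->
     exists p : {perm X}, [/\ blk_perm p, forall x, al (p x) = al x &
                              forall x, nu (r (p x)) = nu x]).
Proof.
have [n] := ubnP #|[set x | nu (r x) != nu x]|.
elim: n r => // n IH r ltn br.
have [D0|[x0 Dx0]] := set_0Vmem [set x | nu (r x) != nu x].
  have nu_r x : nu (r x) = nu x.
    by apply/eqP; move/setP/(_ x): D0; rewrite !inE => /negbT; rewrite negbK.
  under eq_bigr do rewrite nu_r; split=> // _.
  by exists 1%g; split=> x; rewrite perm1.
rewrite inE in Dx0.
case: (@arg_maxnP _ x0 (fun x => nu (r x) != nu x) nu Dx0) => x Dx max_x.
have [y byx /andP[/eqP nury nuyx]] := disagreement_value br Dx.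
have lt_yx : nu y < nu x.
  by rewrite ltn_neqAle nuyx; apply: max_x; rewrite nury eq_sym.
have lt_rx : nu (r x) < nu x.
  have [z bz /andP[/eqP nuz nurz]] := disagreement_value_inv br Dx.
  by rewrite ltn_neqAle Dx -nuz; apply: max_x; rewrite nuz.
have le_al : al y <= al x.
  by rewrite leqNgt; apply/negP => /(comono (esym byx)); rewrite leqNgt lt_yx.
have ne_yx : y != x by apply: contraNneq nuyx => ->.
(* The transposition puts the value nu x in place without disturbing the
   places that were already correct. *)
pose r' := (tperm x y * r)%g.
have r'E z : r' z = r (tperm x y z) by rewrite permM.
have br' : blk_perm r'.
  by move=> z; rewrite r'E br; case: tpermP => // ->; rewrite byx.
have r'x : nu (r' x) = nu x by rewrite r'E tpermL.
have r'y : nu (r' y) = nu (r x) by rewrite r'E tpermR.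
have r'z z : z != x -> z != y -> nu (r' z) = nu (r z).
  by move=> zx zy; rewrite r'E tpermD // eq_sym.
have [|le' eq'] := IH r' _ br'.
  rewrite -ltnS; apply: leq_trans ltn; rewrite ltnS; apply: proper_card.
  apply/properP; split; last by exists x; rewrite !inE ?r'x ?eqxx.
  apply/subsetP=> z; rewrite !inE; have [->|zx] := eqVneq z x.
    by rewrite r'x eqxx.
  have [->|zy] := eqVneq z y; first by rewrite nury [nu x == _]eq_sym nuyx.
  by rewrite r'z.
pose rest (s : {perm X}) := \sum_(z | (z != x) && (z != y)) al z * nu (s z).
have splitS (s : {perm X}) : \sum_z al z * nu (s z) =
    al x * nu (s x) + (al y * nu (s y) + rest s).
  by rewrite (bigD1 x) //= (bigD1 y).
have rest_r : rest r' = rest r.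
  by apply: eq_bigr => z /andP[zx zy]; rewrite r'z.
have step : \sum_z al z * nu (r' z) =
    \sum_z al z * nu (r z) + (al x - al y) * (nu x - nu (r x)).
  rewrite !splitS rest_r r'x r'y nury.
  move: (al x) (al y) (nu x) (nu (r x)) le_al (ltnW lt_rx) => a b u v le1 le2.
  have [a' ->] : exists a', a = a' + b by exists (a - b); rewrite subnK.
  have [u' ->] : exists u', u = u' + v by exists (u - v); rewrite subnK.
  by rewrite !addnK; nia.
split; first by rewrite (leq_trans _ le') // step leq_addr.
move=> eqr; have : (al x - al y) * (nu x - nu (r x)) <= 0.
  by rewrite -(leq_add2l (\sum_z al z * nu (r z))) -step addn0 eqr.
rewrite leqn0 muln_eq0 !subn_eq0 leqNgt [nu x <= _]leqNgt lt_rx orbF -leqNgt => le_xy.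
have al_xy : al x = al y by apply/eqP; rewrite eqn_leq le_xy.
have [|p [bp alp nup]] := eq'; first by apply/eqP; rewrite eqn_leq le' step -eqr leq_addr.
exists (p * tperm x y)%g; split=> z; rewrite permM.
- by case: tpermP => [e|e|_ _]; rewrite -?byx -?(bp z) ?e.
- by case: tpermP => [e|e|_ _]; rewrite -?al_xy -(alp z) ?e ?al_xy.
- by rewrite -r'E nup.
Qed.
End Rearrangement.

Lemma tperm_gain (X : finType) (al nu : X -> nat) c c' :
    (al c < al c')%N -> (nu c' < nu c)%N ->
  (\sum_x al x * nu x < \sum_x al x * nu (tperm c c' x))%N.
Proof.
move=> lt_al lt_nu; have cc' : c' != c by apply: contraTneq lt_al => ->; rewrite ltnn.
rewrite (bigD1 c) // (bigD1 c') //= [ltnRHS](bigD1 c) // (bigD1 c') //=.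
rewrite tpermL tpermR !addnA.
under [X in (_ < _ + X)%N]eq_bigr => x /andP[xc xc'] do
  rewrite tpermD 1?eq_sym //.
by rewrite ltn_add2r; nia.
Qed.

(** * Diagrams *)

Section Diagram.
Local Open Scope nat_scope.
Variables (d : nat) (la : seq nat).
Hypothesis la_d : is_partition d la.
Local Notation row := (@box_row d la).
Local Notation col := (@box_col d la).
Implicit Types (c : 'I_d) (s p q : 'S_d).

Lemma sumn_partition : sumn la = d.
Proof. by case/and3P: la_d => _ _ /eqP. Qed.

Lemma col_lt c : col c < nth 0 la (row c).
Proof. by apply: reshape_offsetP; rewrite sumn_partition. Qed.

Lemma row_lt_size c : row c < size la.
Proof. by apply: reshape_indexP; rewrite sumn_partition. Qed.

Lemma parts_anti i j : i <= j -> nth 0 la j <= nth 0 la i.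
Proof.
move=> le_ij; have [lt_j|ge_j] := ltnP j (size la); last by rewrite nth_default.
have /and3P[sla _ _] := la_d.
by apply: (sorted_leq_nth _ _ 0 sla); rewrite ?inE // ?(leq_ltn_trans le_ij) //;
  [move=> x y z /= h1 h2; apply: leq_trans h2 h1 | move=> x /=].
Qed.

Lemma row_lt c : row c < d.
Proof.
apply: leq_trans (row_lt_size c) _; rewrite -sumn_partition.
have /and3P[_ n0 _] := la_d; elim: (la) n0 => //= x l IH.
by rewrite inE negb_or eq_sym -lt0n => /andP[x0 /IH]; lia.
Qed.

Lemma box_inj c c' : row c = row c' -> col c = col c' -> c = c'.
Proof.
move=> er ec; apply: val_inj.
by rewrite /= -(reshape_indexK la c) -(reshape_indexK la c') -/(row c)
  -/(col c) er ec.
Qed.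

Lemma box_exists r j : j < nth 0 la r -> exists2 c, row c = r & col c = j.
Proof.
move=> lt_j; have ltd : flatten_index la r j < d.
  by rewrite -sumn_partition flatten_indexP.
exists (Ordinal ltd); [exact: flatten_indexKl | exact: flatten_indexKr].
Qed.

Lemma box_left c j : j <= col c -> exists2 c', row c' = row c & col c' = j.
Proof. by move=> le; apply: box_exists; apply: leq_ltn_trans (col_lt c). Qed.

Lemma box_up c r : r <= row c -> exists2 c', row c' = r & col c' = col c.
Proof.
move=> le; apply: box_exists; apply: leq_trans (col_lt c) _.
exact: parts_anti.
Qed.

Lemma row_stabP s : reflect (forall c, row (s c) = row c) (s \in row_stab d la).
Proof. by rewrite inE; apply: (iffP forallP) => h c; apply/eqP. Qed.

Lemma col_stabP s : reflect (forall c, col (s c) = col c) (s \in col_stab d la).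
Proof. by rewrite inE; apply: (iffP forallP) => h c; apply/eqP. Qed.

Lemma row_stabM s p : p \in row_stab d la ->
  ((s * p)%g \in row_stab d la) = (s \in row_stab d la).
Proof.
move=> /row_stabP hp.
by apply/row_stabP/row_stabP => h c; have := h c; rewrite permM hp.
Qed.

Lemma col_stabM s p : p \in col_stab d la ->
  ((s * p)%g \in col_stab d la) = (s \in col_stab d la).
Proof.
move=> /col_stabP hp.
by apply/col_stabP/col_stabP => h c; have := h c; rewrite permM hp.
Qed.

(** * Fillings *)

Definition filling := {ffun 'I_d -> nat}.
Implicit Types b a : filling.

Definition permf b s : filling := [ffun c => b (s c)].

Lemma permfM b s p : permf (permf b s) p = permf b (p * s).
Proof. by apply/ffunP=> c; rewrite !ffunE permM. Qed.

Lemma permf1 b : permf b 1 = b.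
Proof. by apply/ffunP=> c; rewrite !ffunE perm1. Qed.

Definition bounded m b := forall c, b c <= m.

Lemma bounded_permf m b s : bounded m b -> bounded m (permf b s).
Proof. by move=> le c; rewrite ffunE. Qed.

Definition row_weak b :=
  forall c c', row c = row c' -> col c < col c' -> b c <= b c'.
Definition col_strict b :=
  forall c c', col c = col c' -> row c < row c' -> b c < b c'.
Definition semistandard b := row_weak b /\ col_strict b.

(** A set of boxes with one box per row is no larger than a set of boxes that
    meets all of these rows: this is the source of the pigeonholes below. *)
Lemma card_rows (A B : {set 'I_d}) :
    {in A &, injective row} ->
    (forall c, c \in A -> exists2 c', c' \in B & row c' = row c) ->
  #|A| <= #|B|.
Proof.
move=> injA AB; pose f c := odflt c [pick c' in B | row c' == row c].
have fP c : c \in A -> f c \in B /\ row (f c) = row c.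
  move=> /AB[c' Bc' rc']; rewrite /f; case: pickP => [z /andP[Bz /eqP]|] //=.
  by move/(_ c'); rewrite Bc' rc' eqxx.
rewrite -(card_in_imset (f := f)); last first.
  by move=> x y Ax Ay exy; apply: injA => //; rewrite -(fP x Ax).2 -(fP y Ay).2 exy.
by apply/subset_leq_card/subsetP => _ /imsetP[x Ax ->]; case: (fP x Ax).
Qed.

(** A row is sorted in only one way.  Both fillings maximize the sum of
    [col c * b c] over a row, and the equality case of the rearrangement
    inequality yields a permutation fixing rows and columns. *)
Lemma row_weak_inj b b' p : p \in row_stab d la -> b' = permf b p ->
  row_weak b -> row_weak b' -> b = b'.
Proof.
move=> /row_stabP hp def wb wb'.
have hp' c : row (p^-1%g c) = row c by rewrite -hp permKV.
have [le1 _] := rearrangement wb hp; have [le2 eq2] := rearrangement wb' hp'.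
have {}le2 : \sum_c col c * b c <= \sum_c col c * b' c.
  by apply: leq_trans le2; apply/eq_leq/eq_bigr => c _; rewrite def ffunE permKV.
have {}le1 : \sum_c col c * b' c <= \sum_c col c * b c.
  by apply: leq_trans le1; apply/eq_leq/eq_bigr => c _; rewrite def ffunE.
have [|s [rs cs bs]] := eq2.
  transitivity (\sum_c col c * b c).
    by apply/eq_bigr => c _; rewrite def ffunE permKV.
  by apply/eqP; rewrite eqn_leq le1 le2.
apply/ffunP=> c; rewrite -[RHS]bs def ffunE permKV.
by rewrite (@box_inj (s c) c).
Qed.

(** Permuting the columns of a column strict filling pushes small entries
    down.  This is what isolates a semistandard filling among the terms of its
    own Young symmetrization. *)
Lemma col_strict_max b q : q \in col_stab d la -> col_strict b ->
  \sum_c row c * b (q c) <= \sum_c row c * b c /\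
  (\sum_c row c * b (q c) = \sum_c row c * b c -> q = 1%g).
Proof.
move=> /col_stabP hq sb.
have wb c c' : col c = col c' -> row c < row c' -> b c <= b c'.
  by move=> e l; apply/ltnW/sb.
have [le eq] := rearrangement wb hq; split=> // /eq[s [cs rs bs]].
apply/permP=> c; rewrite perm1.
have := bs c; rewrite (@box_inj (s c) c) // => bqc.
apply: box_inj; last exact: hq.
case: (ltngtP (row (q c)) (row c)) => // lt; have := sb _ _ _ lt;
  by rewrite ?hq bqc ltnn => /(_ erefl).
Qed.

End Diagram.

(** * Straightening *)

Lemma sum_neq0 (V : nmodType) (I : finType) (P : pred I) (F : I -> V) :
  \sum_(i | P i) F i != 0 -> exists2 i, P i & F i != 0.
Proof.
move=> ne; have /existsP[i /andP[Pi Fi]] : [exists i, P i && (F i != 0)].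
  apply: contraNT ne => /existsPn no; rewrite big1 // => i Pi.
  by have := no i; rewrite Pi /= negbK => /eqP.
by exists i.
Qed.

Section Straightening.
Variables (k : fieldType) (d : nat) (la : seq nat).
Hypothesis char0 : [pchar k] =i pred0.
Hypothesis la_d : is_partition d la.
Local Notation row := (@box_row d la).
Local Notation col := (@box_col d la).
Local Notation R := (row_stab d la).
Local Notation C := (col_stab d la).
Implicit Types (c : 'I_d) (s p q : 'S_d) (b : filling d).

Lemma natr_eq0_char0 n : (n%:R == 0 :> k) = (n == 0)%N.
Proof. by rewrite (pcharf0P k).1. Qed.

(** The coefficients of f.c, when [G] gives the coefficients of f. *)
Definition young_sum (G : filling d -> k) b : k :=
  \sum_(p in R) \sum_(q in C) (-1) ^+ q * G (permf b (p * q)).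

Variable G : filling d -> k.
Local Notation F := (young_sum G).

Lemma young_sum_neq0 b : F b != 0 ->
  exists p q, [/\ p \in R, q \in C & G (permf b (p * q)) != 0].
Proof.
case/sum_neq0 => p Rp /sum_neq0[q Cq].
by rewrite mulf_eq0 negb_or => /andP[_ ne]; exists p, q.
Qed.

Lemma young_sum_col b q : q \in C -> F (permf b q) = (-1) ^+ q * F b.
Proof.
move=> Cq; rewrite mulr_sumr; apply: eq_bigr => p _.
rewrite mulr_sumr [RHS](reindex_inj (mulIg q)) /=; apply: eq_big => [s|s _].
  by rewrite col_stabM.
by rewrite permfM -mulgA odd_permM signr_addb mulrA mulrCA -expr2 sqrr_sign mulr1.
Qed.

(** The Garnir relation.  In each term of the Young sum, two boxes of one row
    are sent into [Z]; the transposition of these boxes is absorbed by the row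
    symmetrization and is turned by the column permutation into a transposition
    of [Z], which changes the sign. *)
Lemma garnir (Z : {set 'I_d}) b :
    (forall q, q \in C -> exists c, exists c',
       [/\ c != c', row c = row c', q c \in Z & q c' \in Z]) ->
  \sum_(s | perm_on Z s) (-1) ^+ s * F (permf b s) = 0.
Proof.
move=> hZ; rewrite /young_sum.
under eq_bigr do rewrite mulr_sumr; rewrite exchange_big /=.
under eq_bigr do under eq_bigr do rewrite mulr_sumr.
under eq_bigr do rewrite exchange_big /=; rewrite exchange_big /=.
apply: big1 => q Cq; rewrite exchange_big /=.
have [c [c' [cc' rcc' Zc Zc']]] := hZ q Cq.
set S := \sum_(_ | _) _; suffices SN : S = - S.
  have /eqP : S *+ 2 = 0 by rewrite mulr2n {1}SN addNr.
  by rewrite -mulr_natr mulf_eq0 natr_eq0_char0 orbF => /eqP.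
pose t := tperm c c'; pose t' := tperm (q c) (q c').
have tq : (t * q = q * t')%g by rewrite /t' -tpermJ conjgE !mulgA mulgV mul1g.
have Rt : t \in R by apply/row_stabP => x; rewrite /t; case: tpermP => // ->.
have Zt' : perm_on Z t'.
  by apply/subsetP => x; rewrite inE /t'; case: tpermP => [->|->|_ _ /eqP].
have ot' : odd_perm t' by rewrite odd_tperm (inj_eq perm_inj).
rewrite {1}/S (reindex_inj (mulgI t')) -sumrN /=; apply: eq_big => [s|s _].
  apply/idP/idP => [h|]; last exact: perm_onM.
  by rewrite -[s](mulKg t') perm_onM // tpermV.
rewrite -sumrN [LHS](reindex_inj (mulIg t)) /=.
apply: eq_big => [p|p _]; first by rewrite row_stabM.
have -> : permf (permf b (t' * s)) (p * t * q) = permf (permf b s) (p * q).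
  by rewrite !permfM; congr permf; rewrite -!mulgA (mulgA t) tq -!mulgA
    (mulgA t' t') tperm2 mul1g.
by rewrite odd_permM ot' signrN mulNr.
Qed.

(** Exchanging large entries on the left with small entries on the right moves
    large entries to the right, and does so strictly unless no exchange takes
    place, in which case only the columns are permuted. *)
Lemma garnir_gain (X Y : {set 'I_d}) s b u j j' :
    [disjoint X & Y] -> {in X, forall c, col c = j} ->
    {in Y, forall c, col c = j'} -> (j < j')%N ->
    {in X, forall c, (u <= b c)%N} -> {in Y, forall c, (b c < u)%N} ->
    perm_on (X :|: Y) s -> s \notin C ->
  (\sum_c col c * b c < \sum_c col c * b (s c))%N.
Proof.
move=> dXY colX colY ltj bX bY sXY nCs.
(* Up to a function invariant under s, the column index is the indicator
   function of Y. *)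
pose e c := if c \in X :|: Y then j else col c.
have XnY c : c \in X -> (c \in Y) = false by move=> /(disjointFr dXY).
have colE c : col c = (e c + (j' - j) * (c \in Y))%N.
  rewrite /e inE; have [Xc|nXc] := boolP (c \in X).
    by rewrite XnY // muln0 addn0 colX.
  have [Yc|_] /= := boolP (c \in Y); last by rewrite muln0 addn0.
  by rewrite colY // muln1 subnKC // ltnW.
have es c : e (s c) = e c.
  rewrite /e; have [Zc|nZc] := boolP (c \in X :|: Y).
    by rewrite (perm_closed _ sXY) Zc.
  by rewrite (out_perm sXY nZc) (negbTE nZc).
have e_sum : (\sum_c e c * b (s c) = \sum_c e c * b c)%N.
  by rewrite [RHS](reindex_inj (@perm_inj _ s)); apply: eq_bigr => c _; rewrite es.
have split_sum (nu : 'I_d -> nat) : (\sum_c col c * nu c =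
    \sum_c e c * nu c + (j' - j) * \sum_(c in Y) nu c)%N.
  rewrite big_distrr /= [X in (_ + X)%N]big_mkcond -big_split; apply: eq_bigr => c _.
  by rewrite {1}colE mulnDl; case: (c \in Y); rewrite ?muln1 ?muln0.
rewrite !split_sum e_sum ltn_add2l ltn_pmul2l ?subn_gt0 //.
have -> : (\sum_(c in Y) b (s c) = \sum_(c in s @: Y) b c)%N.
  by rewrite big_imset // => x y _ _; apply: perm_inj.
set S := s @: Y; have cardS : #|S| = #|Y| by apply/card_imset/perm_inj.
have Sn0 : (0 < #|Y :\: S|)%N.
  rewrite card_gt0; apply: contraNneq nCs => /eqP; rewrite setD_eq0 => sub.
  have eS : Y = S by apply/eqP; rewrite eqEcard sub cardS leqnn.
  have sY c : c \in Y -> s c \in Y by move=> Yc; rewrite eS imset_f.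
  apply/col_stabP => c; have [Zc|nZc] := boolP (c \in X :|: Y); last first.
    by rewrite (out_perm sXY nZc).
  have := Zc; rewrite -(perm_closed _ sXY) in Zc => Zc'.
  have [Yc|nYc] := boolP (c \in Y); first by rewrite !colY ?sY.
  have Xc : c \in X by move: Zc'; rewrite inE (negbTE nYc) orbF.
  suff Xsc : s c \in X by rewrite !colX.
  move: Zc; rewrite inE => /orP[//|]; rewrite eS => /imsetP[y Yy /perm_inj ey].
  by rewrite ey Yy in nYc.
have cardD : #|S :\: Y| = #|Y :\: S|.
  by apply/eqP; rewrite -(eqn_add2l #|S :&: Y|) cardsID setIC cardsID cardS.
rewrite (big_setID S) [ltnRHS](big_setID Y) setIC ltn_add2l /=.
have lt : (\sum_(c in Y :\: S) (b c).+1 <= u * #|Y :\: S|)%N.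
  by rewrite mulnC -sum_nat_const; apply: leq_sum => c /setDP[Yc _]; apply: bY.
have le : (u * #|Y :\: S| <= \sum_(c in S :\: Y) b c)%N.
  rewrite mulnC -cardD -sum_nat_const; apply: leq_sum => c /setDP[/imsetP[y Yy ec] nYc].
  have : c \in X :|: Y by rewrite ec (perm_closed _ sXY) inE Yy orbT.
  by rewrite inE (negbTE nYc) orbF => /bX.
apply: leq_trans le; apply: leq_trans lt.
under [leqRHS]eq_bigr do rewrite -addn1.
by rewrite big_split /= sum1_card -addn1 leq_add2l.
Qed.

(** The two sets have together one box more than the longer of the two
    columns, and a column permutation does not change which rows are met. *)
Lemma garnir_pigeonhole c1 c2 q : row c1 = row c2 -> (col c1 < col c2)%N -> q \in C ->
  let Z := [set c | (col c == col c1) && (row c1 <= row c)%N] :|: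
           [set c | (col c == col c2) && (row c <= row c1)%N] in
  exists c, exists c', [/\ c != c', row c = row c', q c \in Z & q c' \in Z].
Proof.
move=> er ltc Cq; set X := [set _ | _]; set Y := [set _ | _] => /=.
set Z := X :|: Y; have [/existsP[c /existsP[c' /and4P[]]]|no] :=
    boolP [exists c, exists c', [&& c != c', row c == row c', q c \in Z & q c' \in Z]].
  by move=> ? /eqP ? ? ?; exists c, c'.
exfalso; have dXY : [disjoint X & Y].
  rewrite -setI_eq0; apply/eqP/setP => c; rewrite !inE; apply/negP.
  by case/andP => /andP[/eqP e1 _] /andP[/eqP e2 _]; rewrite -e1 -e2 ltnn in ltc.
have col_q c : col (q c) = col c by move/col_stabP: Cq.
have le1 : (#|q @^-1: Z| <= #|[set c | col c == col c1]|)%N.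
  apply: (card_rows (la := la)) => [x y|x].
    rewrite !inE => Zx Zy exy; apply/eqP; apply: contraNT no => nxy.
    apply/existsP; exists x; apply/existsP; exists y.
    by rewrite nxy exy eqxx !inE Zx Zy.
  rewrite !inE !col_q => h; have [|c' rc' cc'] := box_left la_d (c := x) (j := col c1).
    by case/orP: h => /andP[/eqP-> _] //; apply: ltnW.
  by exists c'; rewrite ?inE ?cc'.
have le2 : (#|[set c | (col c == col c1) && (row c < row c1)%N]| <= #|Y :\ c2|)%N.
  apply: (card_rows (la := la)) => [x y|x].
    rewrite !inE => /andP[/eqP cx _] /andP[/eqP cy _] e.
    by apply: (box_inj (la := la)) => //; rewrite cx.
  rewrite !inE => /andP[_ ltx]; have [|c' rc' cc'] := box_up la_d (c := c2) (r := row x).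
    by rewrite -er ltnW.
  exists c' => //; rewrite !inE cc' eqxx rc' (ltnW ltx) /= andbT.
  by apply: contraTneq ltx => e; rewrite -rc' e er ltnn.
have eZ : #|q @^-1: Z| = (#|X| + #|Y|)%N.
  rewrite card_preimset; last exact: perm_inj.
  by move: dXY; rewrite -setI_eq0 cardsU => /eqP ->; rewrite cards0 subn0.
have eC : #|[set c | col c == col c1]| =
    (#|X| + #|[set c | (col c == col c1) && (row c < row c1)%N]|)%N.
  rewrite -(cardsID X); congr (_ + _)%N; apply: eq_card => c; rewrite !inE.
    by case: eqP.
  by case: eqP => //=; rewrite -ltnNge andbT.
have eY : #|Y| = (#|Y :\ c2|).+1.
  by rewrite (cardsD1 c2) !inE eqxx er leqnn.
by move: le1; rewrite eZ eC eY leq_add2l ltnNge le2.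
Qed.

(** For a filling that is not semistandard, either two entries of a column are
    equal or in the wrong order, and a swap relates it to a better filling; or
    a row decreases, and the Garnir relation expresses its coefficient through
    those of better fillings.  Better means of larger weight [wt]: larger
    entries in columns further to the right or, within a column, further down.
    *)
Lemma straightening m :
    (forall b, bounded m b -> semistandard la b -> F b = 0) ->
  forall b, bounded m b -> F b = 0.
Proof.
move=> F0 b le_b.
(* B makes the column index dominate the row index. *)
pose B := ((\sum_c @row c) * m).+1; pose al c := (col c * B + row c)%N.
pose wt b := (\sum_c al c * b c)%N.
pose K := ((\sum_c al c) * m)%N.
have wt_le b' : bounded m b' -> (wt b' <= K)%N.
  by move=> le; rewrite /K big_distrl; apply: leq_sum => c _; apply: leq_mul.
have wtE b' : wt b' = (B * (\sum_c col c * b' c) + \sum_c row c * b' c)%N.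
  rewrite big_distrr -big_split; apply: eq_bigr => c _ /=.
  by rewrite mulnDl mulnAC mulnC mulnA.
have [n] := ubnP (K - wt b)%N; elim: n b le_b => // n IH b le_b lt_n.
have step s : (wt b < wt (permf b s))%N -> F (permf b s) = 0.
  move=> lt_wt; apply: (IH _ (bounded_permf s le_b)).
  by have := wt_le _ (bounded_permf s le_b); move: lt_n lt_wt; lia.
have col_swap c c' : col c = col c' -> tperm c c' \in C.
  by move=> e; apply/col_stabP => x; case: tpermP => // ->.
have [/existsP[c /existsP[c' /and3P[/eqP ec rcc' bb]]]|strict] :=
    boolP [exists c, exists c', [&& col c == col c', row c < row c' & b c' <= b c]%N].
  have cc' : c != c' by apply: contraTneq rcc' => ->; rewrite ltnn.
  have := young_sum_col b (col_swap _ _ ec); rewrite odd_tperm cc' expr1 mulN1r.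
  move: bb; rewrite leq_eqVlt => /orP[/eqP eb|lt_b].
    have -> : permf b (tperm c c') = b.
      by apply/ffunP => x; rewrite ffunE; case: tpermP => // ->.
    move=> eF; have /eqP : F b *+ 2 = 0 by rewrite mulr2n {1}eF addNr.
    by rewrite -mulr_natr mulf_eq0 natr_eq0_char0 orbF => /eqP.
  rewrite step => [/eqP|]; first by rewrite eq_sym oppr_eq0 => /eqP.
  rewrite /wt; under [ltnRHS]eq_bigr do rewrite ffunE.
  by apply: tperm_gain => //; rewrite /al ec ltn_add2l.
have sb : col_strict la b.
  move=> c c' ec rc; rewrite ltnNge; apply: contra strict => le.
  by apply/existsP; exists c; apply/existsP; exists c'; rewrite ec eqxx rc.
have [/existsP[c1 /existsP[c2 /and3P[/eqP er ltc lt_b]]]|weak] :=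
    boolP [exists c, exists c', [&& row c == row c', col c < col c' & b c' < b c]%N];
  last first.
  apply: F0 => //; split=> // c c' er ltc; rewrite leqNgt; apply: contra weak => lt.
  by apply/existsP; exists c; apply/existsP; exists c'; rewrite er eqxx ltc.
have := garnir b (fun q => garnir_pigeonhole er ltc (q := q)).
set X := [set _ | _]; set Y := [set _ | _ && (_ <= row c1)%N].
have dXY : [disjoint X & Y].
  rewrite -setI_eq0; apply/eqP/setP => c; rewrite !inE; apply/negP.
  by case/andP => /andP[/eqP e1 _] /andP[/eqP e2 _]; rewrite -e1 -e2 ltnn in ltc.
rewrite (bigID (fun s => s \in C)) /= [X in _ + X]big1 => [|s /andP[Zs nCs]].
  rewrite addr0 (eq_bigr (fun _ => F b)) => [|s /andP[_ Cs]].
    rewrite sumr_const -mulr_natr => /eqP; rewrite mulf_eq0 natr_eq0_char0.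
    case/orP => [/eqP //|/eqP/card0_eq/(_ 1%g)].
    have C1 : 1%g \in C by apply/col_stabP => c; rewrite perm1.
    by rewrite unfold_in /= C1 andbT perm_on1.
  by rewrite young_sum_col // mulrA -expr2 sqrr_sign mul1r.
rewrite step ?mulr0 // !wtE.
have ltB : (\sum_c row c * b c < B)%N.
  by rewrite /B ltnS big_distrl; apply: leq_sum => c _; apply: leq_mul.
have lt_col : (\sum_c col c * b c < \sum_c col c * permf b s c)%N.
  under [ltnRHS]eq_bigr do rewrite ffunE.
  apply: (@garnir_gain X Y s b (b c1) (col c1) (col c2)) => // c.
  - by rewrite inE => /andP[/eqP].
  - by rewrite inE => /andP[/eqP].
  - rewrite inE => /andP[/eqP ec]; rewrite leq_eqVlt => /orP[/eqP rc|rc].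
      by rewrite (box_inj (la := la) (c := c) (c' := c1)).
    by apply/ltnW/sb.
  - rewrite inE => /andP[/eqP ec]; rewrite leq_eqVlt => /orP[/eqP rc|rc].
      by rewrite (box_inj (la := la) (c := c) (c' := c2)) // rc.
    by apply: ltn_trans lt_b; apply: sb; rewrite // -er.
apply: leq_trans (leq_addr _ _); apply: leq_trans (leq_mul (leqnn B) lt_col).
by rewrite mulnS addnC ltn_add2r.
Qed.

End Straightening.

(** * Tableaux and semistandard fillings *)

Section Tableau.
Local Open Scope nat_scope.
Variables (d : nat) (la : seq nat).
Local Notation row := (@box_row d la).
Local Notation col := (@box_col d la).
Implicit Types (T : SYT d la) (c : 'I_d) (s p q : 'S_d) (b a mu : filling d).

(** This is des when n = d - 1; the partial counts are the entries of the
    filling attached to the tableau. *)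
Definition descents_upto T n := \sum_(1 <= j < n.+1 | descent la T j) 1.
Local Notation D := descents_upto.

Lemma descents_upto0 T : D T 0 = 0.
Proof. by rewrite /D big_geq. Qed.

Lemma descents_uptoS T n : D T n.+1 = D T n + descent la T n.+1.
Proof. by rewrite /D big_mkcond big_nat_recr //= -big_mkcond; case: descent. Qed.

Lemma descents_upto_mono T : {homo D T : i j / i <= j}.
Proof.
move=> i j le; rewrite -(subnK le); elim: (j - i) => // n IH.
by rewrite addSn descents_uptoS (leq_trans IH) // leq_addr.
Qed.

Lemma descents_upto_des T : 0 < d -> D T d.-1 = des T.
Proof. by move=> d0; rewrite /D prednK. Qed.

(** A descent j is counted by the d - j values j, ..., d - 1 of [n]. *)
Lemma descents_upto_sum T : \sum_(n < d) D T n + maj T = d * des T.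
Proof.
suff H n : \sum_(i < n) D T i + \sum_(1 <= j < n | descent la T j) j =
   n * \sum_(1 <= j < n | descent la T j) 1 by apply: H.
elim: n => [|n IH]; first by rewrite big_ord0 big_geq.
rewrite big_ord_recr /=; case: n IH => [|n] IH.
  by rewrite big_ord0 descents_upto0 !big_geq.
have recr (F : nat -> nat) : \sum_(1 <= j < n.+2 | descent la T j) F j =
    \sum_(1 <= j < n.+1 | descent la T j) F j + descent la T n.+1 * F n.+1.
  by rewrite big_mkcond big_nat_recr //= -big_mkcond; case: descent; rewrite ?mul1n.
rewrite !recr descents_uptoS /D; move: IH; set x := \sum_(i < n.+1) _.
set y := bigop _ _ _; set z := bigop _ _ _.
by case: descent; lia.
Qed.

Lemma std_row T c c' : row c = row c' -> col c < col c' -> T c < T c'.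
Proof.
move=> er lt; have /forallP/(_ c)/forallP/(_ c')/andP[+ _] := valP T.
by rewrite /entry !ltnS er eqxx lt.
Qed.

Lemma std_col T c c' : col c = col c' -> row c < row c' -> T c < T c'.
Proof.
move=> er lt; have /forallP/(_ c)/forallP/(_ c')/andP[_] := valP T.
by rewrite /entry !ltnS er eqxx lt.
Qed.

Definition desc_filling T : filling d := [ffun c => D T (T c)].

Lemma desc_filling_le T c : 0 < d -> desc_filling T c <= des T.
Proof.
move=> d0; rewrite ffunE -descents_upto_des //; apply: descents_upto_mono.
by rewrite -ltnS prednK.
Qed.

Lemma desc_filling_sum T : \sum_c desc_filling T c + maj T = d * des T.
Proof.
rewrite -descents_upto_sum; congr (_ + _).
rewrite [RHS](reindex_inj (@perm_inj _ T)).
by apply: eq_bigr => c _; rewrite ffunE.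
Qed.

Hypothesis la_d : is_partition d la.

(** Compare with the box in the row of [c] and the column of [c']. *)
Lemma std_right T c c' : T c < T c' -> row c' <= row c -> col c < col c'.
Proof.
move=> ltT le_r; rewrite ltnNge; apply: contraTN ltT => le_c; rewrite -leqNgt.
have [z rz cz] := box_left la_d le_c; apply: (@leq_trans (T z)).
  case: (ltngtP (row c') (row z)) => [lt|lt|e]; first exact/ltnW/std_col.
    by rewrite rz ltnNge le_r in lt.
  by rewrite (box_inj (la := la) (c := z) (c' := c')).
case: (ltngtP (col z) (col c)) => [lt|lt|e]; first exact/ltnW/std_row.
  by rewrite cz ltnNge le_c in lt.
by rewrite (box_inj (la := la) (c := z) (c' := c)).
Qed.

(** Along a run of consecutive entries without descents, rows can only go up;
    such a run therefore fills a horizontal strip from left to right. *)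
Lemma no_descent_rows T c c' :
  T c <= T c' -> D T (T c) = D T (T c') -> row c' <= row c.
Proof.
move=> le; have [n] : exists n, T c' = n + T c :> nat.
  by exists (T c' - T c); rewrite subnK.
elim: n c' {le} => [|n IH] c' def eD.
  by rewrite (@perm_inj _ T c c') //; apply: val_inj; rewrite /= def.
have lt_d : n + T c < d by rewrite ltnW // -addSn -def.
have [z Tz] : exists z, T z = n + T c :> nat.
  by exists ((syt_perm T)^-1%g (Ordinal lt_d)); rewrite permKV.
have le1 : D T (T c) <= D T (T z) by apply: descents_upto_mono; rewrite Tz leq_addl.
move: eD; rewrite def addSn -Tz descents_uptoS => eD.
have eDz : D T (T c) = D T (T z) by lia.
apply: leq_trans (IH _ Tz eDz); rewrite leqNgt; apply/negP => lt_r.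
have : descent la T (T z).+1.
  apply/existsP; exists z; apply/existsP; exists c'.
  by rewrite /entry eqxx def Tz -addSn eqxx lt_r.
by move=> de; move: eD; rewrite de; lia.
Qed.

Definition monotone mu := [forall i : 'I_d, forall j : 'I_d, (i <= j) ==> (mu i <= mu j)].

Lemma monotoneP mu : reflect (forall i j : 'I_d, i <= j -> mu i <= mu j) (monotone mu).
Proof.
apply: (iffP forallP) => [h i j le|h i]; first by have /forallP/(_ j) := h i; rewrite le.
by apply/forallP => j; apply/implyP/h.
Qed.

(** [mu] is read along the entries of [T]. *)
Definition std_filling T mu : filling d := [ffun c => desc_filling T c + mu (T c)].

Section StdFilling.
Variables (T : SYT d la) (mu : filling d).
Hypothesis mono : monotone mu.
Local Notation b := (std_filling T mu).

Lemma std_filling_mono c c' : T c <= T c' -> b c <= b c'.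
Proof.
move=> le; rewrite !ffunE leq_add //; first exact: descents_upto_mono.
exact: (monotoneP _ mono).
Qed.

Lemma std_filling_rows c c' : T c <= T c' -> b c = b c' -> row c' <= row c.
Proof.
move=> le; rewrite !ffunE => e; apply: (no_descent_rows le).
have := descents_upto_mono T le; have := monotoneP _ mono _ _ le; lia.
Qed.

(** The tableau can be recovered from the filling: boxes with equal entries
    form a horizontal strip, numbered from left to right. *)
Lemma std_filling_order c c' :
  (T c < T c') = (b c < b c') || (b c == b c') && (col c < col c').
Proof.
have lex x y : T x < T y -> (b x < b y) || (b x == b y) && (col x < col y).
  move=> lt; have := std_filling_mono (ltnW lt); rewrite leq_eqVlt.
  case: eqP => [e _|_ /= -> //].
  by rewrite (std_right lt (std_filling_rows (ltnW lt) e)) orbT.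
case: (ltngtP (T c) (T c')) => [/lex -> //|/lex|/val_inj/perm_inj ->].
  by case: (ltngtP (b c)) => //= _; case: (ltngtP (col c)).
by rewrite !ltnn andbF.
Qed.

Lemma std_filling_semistandard : semistandard la b.
Proof.
split=> c c' e lt; first exact/std_filling_mono/ltnW/std_row.
have ltT := std_col T e lt.
rewrite ltn_neqAle (std_filling_mono (ltnW ltT)) andbT.
apply: contraTneq lt => eb; rewrite -leqNgt.
exact: std_filling_rows (ltnW ltT) eb.
Qed.
End StdFilling.

Lemma perm_card_lt s c : #|[set c' | s c' < s c]| = s c.
Proof.
have -> : [set c' | s c' < s c] = s @^-1: [set i : 'I_d | i < s c].
  by apply/setP => x; rewrite !inE.
rewrite card_preimset; last exact: perm_inj.
rewrite -sum1dep_card -(big_ord_widen_cond _ xpredT (fun=> 1)) ?sum1_card ?card_ord //.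
exact: ltnW.
Qed.

Lemma std_filling_inj T T' mu mu' : monotone mu -> monotone mu' ->
  std_filling T mu = std_filling T' mu' -> T = T' /\ mu = mu'.
Proof.
move=> mono mono' e; have eT : T = T'.
  apply/val_inj/permP => c; apply: val_inj; rewrite /= -perm_card_lt -[RHS]perm_card_lt.
  apply: eq_card => x; rewrite !inE.
  by rewrite (std_filling_order T mono) (std_filling_order T' mono') e.
split=> //; apply/ffunP => i.
have := congr1 (fun f : filling d => f ((syt_perm T)^-1%g i)) e.
by rewrite /= !ffunE -eT !permKV => /addnI.
Qed.

(** [T] numbers the boxes by increasing entry, and from left to right among
    equal entries.  At a descent of [T] the entry must increase strictly, since
    otherwise a column would contain two equal entries; hence subtracting the
    descent counts leaves a weakly increasing sequence. *)
Lemma standardization b : semistandard la b ->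
  exists T mu, monotone mu /\ b = std_filling T mu.
Proof.
move=> [wb sb].
pose lt c c' := (b c < b c') || (b c == b c') && (col c < col c').
have lt_irr c : lt c c = false by rewrite /lt !ltnn andbF.
have lt_trans c2 c1 c3 : lt c1 c2 -> lt c2 c3 -> lt c1 c3 by rewrite /lt; lia.
have lt_total c c' : c != c' -> lt c c' || lt c' c.
  move=> ne; rewrite /lt; case: (ltngtP (b c)) => //= eb.
  case: (ltngtP (col c)) => //= ec; case/eqP: ne.
  case: (ltngtP (row c) (row c')) => [h|h|h].
  - by have := sb _ _ ec h; rewrite eb ltnn.
  - by have := sb _ _ (esym ec) h; rewrite eb ltnn.
  - exact: box_inj h ec.
have rk_lt c : #|[set x | lt x c]| < d.
  rewrite -[X in _ < X]card_ord -[ltnRHS]cardsT; apply: proper_card.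
  by apply/properP; split; [apply: subsetT | exists c; rewrite !inE ?lt_irr].
pose rk c := Ordinal (rk_lt c).
have rk_mono c c' : lt c c' -> rk c < rk c'.
  move=> ltc /=; apply: proper_card; apply/properP; split.
    by apply/subsetP => x; rewrite !inE => /lt_trans; apply.
  by exists c; rewrite !inE ?lt_irr.
have rk_inj : injective rk.
  move=> c c' /(congr1 val) /= e; apply/eqP/negPn/negP => /lt_total.
  by case/orP => /rk_mono /=; rewrite e ltnn.
pose s := perm rk_inj.
have s_lt c c' : (s c < s c') = lt c c'.
  rewrite !permE; apply/idP/idP => [|/rk_mono //].
  have [->|/lt_total/orP[//|/rk_mono]] := eqVneq c c'; first by rewrite ltnn.
  by move=> h1 h2; have := ltn_trans h1 h2; rewrite ltnn.
have std : is_standard la s.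
  apply/forallP => c; apply/forallP => c'; rewrite /entry !ltnS !s_lt.
  apply/andP; split; apply/implyP => /andP[/eqP e lt'].
    by rewrite /lt lt' andbT orbC -leq_eqVlt; apply: wb.
  by rewrite /lt sb.
have [T T_lt] : exists T : SYT d la, forall c c', (T c < T c') = lt c c'.
  by exists (Syt std).
(* At a descent, the box in the column of c and the row of c' has an entry
   larger than that of c and at most that of c'. *)
have no_desc c c' : T c' = (T c).+1 :> nat -> b c + descent la T (T c') <= b c'.
  move=> step; have : lt c c' by rewrite -T_lt step.
  have [/existsP[c1 /existsP[c2 /and3P[/eqP e1 /eqP e2 ltr]]]|_] :=
    boolP (descent la T (T c')); last by rewrite /lt; lia.
  have ec : c1 = c.
    by apply: (@perm_inj _ T); apply: val_inj; move: e1; rewrite /entry step => -[].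
  have ec' : c2 = c'.
    by apply: (@perm_inj _ T); apply: val_inj; move: e2; rewrite /entry => -[].
  rewrite {}ec {}ec' in ltr; rewrite addn1 /lt => /orP[//|/andP[/eqP eb ltc]].
  have [z rz cz] := box_left la_d (ltnW ltc).
  apply: (@leq_trans (b z)); first by apply: sb; rewrite ?cz ?rz.
  by apply: wb; rewrite ?cz ?rz.
pose B (i : 'I_d) := b ((syt_perm T)^-1%g i).
have D_le n (i j : 'I_d) : j = n + i :> nat -> B i + D T j <= B j + D T i.
  elim: n j => [|n IH] j def; first by rewrite (val_inj def : j = i).
  have lt_d : n + i < d by rewrite ltnW // -addSn -def.
  have := IH (Ordinal lt_d) erefl.
  have := no_desc ((syt_perm T)^-1%g (Ordinal lt_d)) ((syt_perm T)^-1%g j).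
  rewrite !permKV /B /= def addSn descents_uptoS => /(_ erefl).
  set x := b _; set y := b _; set z := b _; lia.
have D_le_B (i : 'I_d) : D T i <= B i.
  have lt0 : 0 < d := leq_ltn_trans (leq0n _) (ltn_ord i).
  by have := @D_le i (Ordinal lt0) i; rewrite addn0 descents_upto0 => /(_ erefl); lia.
exists T, [ffun i => B i - D T i]; split.
  apply/monotoneP => i j le; rewrite !ffunE.
  have := @D_le (j - i) i j; rewrite subnK // => /(_ erefl).
  by have := D_le_B i; have := D_le_B j; lia.
by apply/ffunP => c; rewrite !ffunE /B permK subnKC // -[in leqRHS](permK T c).
Qed.

Lemma std_filling_bound T mu m : 0 < d -> monotone mu ->
    bounded m (std_filling T mu) ->
  des T <= m /\ bounded (m - des T) mu.
Proof.
move=> d0 /monotoneP mono le_m; have ltd : d.-1 < d by rewrite prednK.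
have := le_m ((syt_perm T)^-1%g (Ordinal ltd)).
rewrite !ffunE permKV descents_upto_des // => le; split=> [|i]; first by lia.
have : mu i <= mu (Ordinal ltd) by apply: mono; rewrite -ltnS /= prednK.
lia.
Qed.

(** * The energy of a filling *)

(** The quadratic term depends on the content only.  The linear term gives more
    weight to higher rows; as [0 < d - row c <= d], it only breaks the ties that
    the quadratic term leaves when [mu] is added to a descent filling. *)
Definition energy b := \sum_c (d * b c ^ 2 + (d - row c) * b c).

Lemma sum_permf (f : nat -> nat) b s : \sum_c f (permf b s c) = \sum_c f (b c).
Proof.
by rewrite [RHS](reindex_inj (@perm_inj _ s)); apply: eq_bigr => c _; rewrite ffunE.
Qed.

Lemma energy_rows b : energy b + \sum_c row c * b c = \sum_c (d * b c ^ 2 + d * b c).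
Proof.
rewrite -big_split; apply: eq_bigr => c _ /=.
by rewrite -addnA -mulnDl subnK // ltnW // (row_lt la_d).
Qed.

(** The energy is affine in the rearrangement of [mu]: the quadratic part of
    [mu] does not depend on it. *)
Lemma energy_std T mu s : energy [ffun c => desc_filling T c + permf mu (s) c] =
  \sum_c (d * desc_filling T c ^ 2 + (d - row c) * desc_filling T c) +
  (\sum_c (2 * d * desc_filling T c + (d - row c)) * permf mu s c +
   d * \sum_c mu c ^ 2).
Proof.
rewrite -(sum_permf (fun x => x ^ 2) mu s) big_distrr -!big_split /=.
by apply: eq_bigr => c _; rewrite !ffunE; nia.
Qed.

(** The leading term.  Column permutations can only raise the energy above
    that of a semistandard filling, and among the rearrangements of [mu] the
    one along [T] has the largest energy, because its coefficient
    [2 * d * a_T(c) + (d - row c)] is weakly increasing along [T]: inside a run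
    without descents the rows go up.  If nothing is lost, the remaining
    ambiguity is a row permutation, and semistandard fillings have sorted
    rows. *)
Lemma energy_std_filling T mu b p q s :
    monotone mu -> semistandard la b -> p \in row_stab d la -> q \in col_stab d la ->
    permf b (p * q) = [ffun c => desc_filling T c + permf mu s c] ->
  energy b <= energy (std_filling T mu) /\
  (energy b = energy (std_filling T mu) -> q = 1%g /\ b = std_filling T mu).
Proof.
move=> mono [wb sb] Rp Cq; set a := [ffun c => _] => def.
have [le_q eq_q] := col_strict_max (la := la) Cq sb.
have row_a : \sum_c row c * b (q c) = \sum_c row c * a c.
  rewrite (reindex_inj (@perm_inj _ p)) -def; apply: eq_bigr => c _.
  by move/row_stabP: Rp => ->; rewrite ffunE permM.
have E_a : energy b + \sum_c row c * b c = energy a + \sum_c row c * a c.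
  by rewrite !energy_rows -(sum_permf (fun x => d * x ^ 2 + d * x) b (p * q)) def.
have le_a : energy b <= energy a by lia.
pose al c := 2 * d * desc_filling T c + (d - row c).
pose nu c := mu (T c).
have d_row c : 0 < d - row c <= d by rewrite subn_gt0 (row_lt la_d) leq_subr.
have comono c c' : tt = tt -> al c < al c' -> nu c <= nu c'.
  move=> _ lt; apply: (monotoneP _ mono); rewrite leqNgt; apply/negP => ltT.
  have := descents_upto_mono T (ltnW ltT); rewrite leq_eqVlt => /orP[/eqP e|ltD].
    have := no_descent_rows (ltnW ltT) e; move: lt; rewrite /al !ffunE e; lia.
  have := d_row c; have := d_row c'; move: lt; rewrite /al !ffunE; nia.
pose r := (s * (syt_perm T)^-1)%g.
have nu_r c : nu (r c) = permf mu s c by rewrite ffunE /nu permM permKV.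
have [|le_r eq_r] := @rearrangement _ _ (fun=> tt) al nu comono r; first by [].
have stdE : std_filling T mu = [ffun c => desc_filling T c + permf mu T c].
  by apply/ffunP => c; rewrite !ffunE.
have E_r : energy a + \sum_c al c * nu c =
    energy (std_filling T mu) + \sum_c al c * nu (r c).
  have -> : \sum_c al c * nu (r c) =
      \sum_c (2 * d * desc_filling T c + (d - row c)) * permf mu s c.
    by apply: eq_bigr => c _; rewrite nu_r.
  have -> : \sum_c al c * nu c =
      \sum_c (2 * d * desc_filling T c + (d - row c)) * permf mu T c.
    by apply: eq_bigr => c _; rewrite [permf _ _ _]ffunE.
  by rewrite stdE !energy_std; lia.
have le_E : energy a <= energy (std_filling T mu).
  by rewrite -(leq_add2r (\sum_c al c * nu c)) E_r leq_add2l.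
split=> [|eE]; first exact: leq_trans le_a le_E.
have q1 : q = 1%g by apply: eq_q; lia.
split=> //; have [|w [_ alw nuw]] := eq_r.
  apply/eqP; rewrite eqn_leq le_r -(leq_add2l (energy (std_filling T mu))) -E_r.
  by rewrite leq_add2r -eE.
have w_desc c : desc_filling T (w c) = desc_filling T c.
  by have := d_row c; have := d_row (w c); have := alw c; rewrite /al; nia.
have w_row c : row (w c) = row c.
  have := alw c; rewrite /al w_desc => /addnI.
  by have := d_row c; have := d_row (w c); lia.
have [wstd _] := std_filling_semistandard T mono.
have Rwp : (w * p)%g \in row_stab d la by rewrite row_stabM //; apply/row_stabP.
apply: (row_weak_inj Rwp _ wb wstd).
apply/ffunP => c; rewrite -permfM -[p]mulg1 -q1 def stdE.
rewrite ffunE [RHS]ffunE /a [RHS]ffunE w_desc -nu_r nuw; congr (_ + _).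
by rewrite ffunE.
Qed.

End Tableau.

(** * Monomials of the generic matrix *)

Section Monomials.
Variables (k : fieldType) (d : nat).
Local Notation S := (SymUd k d).
Local Notation mxi := (@mxvec_index d 2).
Implicit Types (mon : 'X_{1..d * 2}) (s : 'S_d) (b : filling d) (f : {mpoly k[d * 2]}).

Definition mnm_of (e : 'I_d -> 'I_2 -> nat) : 'X_{1..d * 2} :=
  [multinom mxvec (\matrix_(i, j) e i j) 0%R x | x < d * 2].

Lemma mnm_ofE e i j : mnm_of e (mxi i j) = e i j.
Proof. by rewrite mnmE mxvecE mxE. Qed.

Lemma mnm_eqP mon mon' :
  (forall i j, mon (mxi i j) = mon' (mxi i j)) <-> mon = mon'.
Proof.
by split=> [e|-> //]; apply/mnmP => x; case/mxvec_indexP: x => i j.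
Qed.

Definition mperm mon s := mnm_of (fun i j => mon (mxi (s i) j)).

Lemma mpermE mon s i j : mperm mon s (mxi i j) = mon (mxi (s i) j).
Proof. exact: mnm_ofE. Qed.

Lemma mpermM mon s t : mperm (mperm mon s) t = mperm mon (t * s).
Proof. by apply/mnm_eqP => i j; rewrite !mpermE permM. Qed.

Lemma mperm1 mon : mperm mon 1 = mon.
Proof. by apply/mnm_eqP => i j; rewrite mpermE perm1. Qed.

Lemma mpermK s : cancel (mperm^~ s) (mperm^~ s^-1%g).
Proof. by move=> mon; rewrite mpermM mulVg mperm1. Qed.

Lemma mpermVK s : cancel (mperm^~ s^-1%g) (mperm^~ s).
Proof. by move=> mon; rewrite mpermM mulgV mperm1. Qed.

Lemma factor_deg_perm mon s i : factor_deg i (mperm mon s) = factor_deg (s i) mon.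
Proof. by apply: eq_bigr => j _; rewrite mpermE. Qed.

Lemma prod_mxvec (F : 'I_(d * 2) -> S) : \prod_x F x = \prod_i \prod_j F (mxi i j).
Proof.
rewrite pair_big /= (reindex _ (curry_mxvec_bij d 2)) /=.
by apply: eq_bigr => -[i j].
Qed.

Lemma perm_actX s mon : perm_act s 'X_[k, mon] = 'X_[mperm mon s^-1].
Proof.
rewrite /perm_act /subst comp_mpolyX mpolyXE_id !prod_mxvec.
rewrite [RHS](reindex_inj (@perm_inj _ s)) /=.
apply: eq_bigr => i _; apply: eq_bigr => j _.
by rewrite tnth_mktuple mxvecE !mxE mpermE permK.
Qed.

Lemma gl_act_diagX (t : 'rV[k]_2) mon : gl_act (diag_mx t) 'X_[k, mon] =
  (\prod_j t 0 j ^+ (\sum_i mon (mxi i j))) *: 'X_[mon].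
Proof.
rewrite /gl_act /subst comp_mpolyX mpolyXE_id !prod_mxvec.
under [X in X *: _]eq_bigr do rewrite -prodrXr.
rewrite exchange_big /= -mul_mpolyC rmorph_prod /= [X in _ * X]exchange_big.
rewrite -big_split; apply: eq_bigr => j _ /=.
rewrite rmorph_prod -big_split; apply: eq_bigr => i _ /=.
rewrite tnth_mktuple mxvecE map_diag_mx mul_mx_diag !mxE rmorphXn /= -exprMn.
by rewrite mulrC.
Qed.

(** Both actions needed below permute monomials up to scalars, so they are
    described by their effect on coefficients. *)
Lemma mcoeff_subst (h : {additive S -> S}) (chi : 'X_{1..d * 2} -> k) F G :
    (forall c f, h (c *: f) = c *: h f) -> cancel F G -> cancel G F ->
    (forall mon, h 'X_[mon] = chi mon *: 'X_[F mon]) ->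
  forall f mon, (h f)@_mon = chi (G mon) * f@_(G mon).
Proof.
move=> hZ FK GK hX f mon; rewrite [in LHS](mpolyE f) [in RHS](mpolyE f).
rewrite !raddf_sum mulr_sumr /=.
apply: eq_bigr => m _; rewrite hZ hX !mcoeffZ !mcoeffX mulrCA.
have -> : (F m == mon) = (m == G mon) by rewrite -{1}(GK mon) (can_eq FK).
by case: eqP => [->|]; rewrite ?mulr0.
Qed.

Lemma mcoeff_perm_act s (f : S) mon : (perm_act s f)@_mon = f@_(mperm mon s).
Proof.
rewrite [LHS](@mcoeff_subst _ (fun=> 1) _ _ _ (mpermVK s) (mpermK s)) ?mul1r //.
  by move=> c p /=; apply: comp_mpolyZ.
by move=> m; rewrite scale1r; apply: perm_actX.
Qed.

Definition torus_char (t : 'rV[k]_2) mon := \prod_j t 0 j ^+ (\sum_i mon (mxi i j)).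

Lemma mcoeff_gl_act_diag (t : 'rV[k]_2) (f : S) mon :
  (gl_act (diag_mx t) f)@_mon = torus_char t mon * f@_mon.
Proof.
rewrite [LHS](@mcoeff_subst _ (torus_char t) id id) //.
  by move=> c p /=; apply: comp_mpolyZ.
by move=> m; apply: gl_act_diagX.
Qed.

Lemma perm_actZ s c (f : S) : perm_act s (c *: f) = c *: perm_act s f.
Proof. exact: comp_mpolyZ. Qed.

Lemma perm_actB s (f g : S) : perm_act s (f - g) = perm_act s f - perm_act s g.
Proof. exact: raddfB. Qed.

Lemma perm_act0 s : perm_act s 0 = 0 :> S.
Proof. exact: raddf0. Qed.

Lemma perm_actM s (f g : S) : perm_act s (f * g) = perm_act s f * perm_act s g.
Proof. exact: rmorphM. Qed.

Lemma perm_act_sum s (I : Type) (r : seq I) P (F : I -> S) :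
  perm_act s (\sum_(i <- r | P i) F i) = \sum_(i <- r | P i) perm_act s (F i).
Proof. exact: raddf_sum. Qed.

Lemma perm_act_comp s t (f : S) : perm_act t (perm_act s f) = perm_act (s * t) f.
Proof. by apply/mpolyP => mon; rewrite !mcoeff_perm_act mpermM. Qed.

Lemma perm_act1 (f : S) : perm_act 1 f = f.
Proof. by apply/mpolyP => mon; rewrite mcoeff_perm_act mperm1. Qed.

Lemma gl_actM h (f g : S) : gl_act h (f * g) = gl_act h f * gl_act h g.
Proof. exact: rmorphM. Qed.

Lemma gl_act_sum h (I : Type) (r : seq I) P (F : I -> S) :
  gl_act h (\sum_(i <- r | P i) F i) = \sum_(i <- r | P i) gl_act h (F i).
Proof. exact: raddf_sum. Qed.

Lemma gl_actZ h c (f : S) : gl_act h (c *: f) = c *: gl_act h f.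
Proof. exact: comp_mpolyZ. Qed.

(** The monomial prod_i x_i^(m - b_i) y_i^(b_i), with x and y the two columns of
    the generic matrix; it has degree m in each factor when b <= m. *)
Definition mnm m b := mnm_of (fun i j => if j == 0%R then (m - b i)%N else b i).

Lemma mnm0E m b i : mnm m b (mxi i 0) = (m - b i)%N.
Proof. exact: mnm_ofE. Qed.

Lemma mnm1E m b i : mnm m b (mxi i 1) = b i.
Proof. exact: mnm_ofE. Qed.

Lemma ord2P (P : 'I_2 -> Prop) : P 0 -> P 1 -> forall j, P j.
Proof.
by move=> P0 P1 [[|[|//]] lt]; [move: P0 | move: P1]; congr P; apply: val_inj.
Qed.

Lemma mnm_intro mon m b : (forall i, mon (mxi i 0) = (m - b i)%N) ->
  (forall i, mon (mxi i 1) = b i) -> mon = mnm m b.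
Proof.
move=> e0 e1; apply/mnm_eqP => i; apply: ord2P; first by rewrite e0 mnm0E.
by rewrite e1 mnm1E.
Qed.

Lemma mnm_permf m b s : mnm m (permf b s) = mperm (mnm m b) s.
Proof.
by apply/esym/mnm_intro => i; rewrite mpermE ?mnm0E ?mnm1E ffunE.
Qed.

Lemma mnm_fillD m m' b b' : bounded m b -> bounded m' b' ->
  (mnm m b + mnm m' b')%MM = mnm (m + m') [ffun c => b c + b' c]%N.
Proof.
move=> le le'; apply: mnm_intro => i; rewrite mnmDE ?mnm0E ?mnm1E ffunE //.
by have := le i; have := le' i; lia.
Qed.

Lemma factor_degE i mon : factor_deg i mon = (mon (mxi i 0%R) + mon (mxi i 1%R))%N.
Proof.
rewrite /factor_deg big_ord_recr big_ord1 /=.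
by congr (mon (mxi _ _) + mon (mxi _ _))%N; apply: val_inj.
Qed.

Lemma factor_deg_mnm i m b : bounded m b -> factor_deg i (mnm m b) = m.
Proof. by move=> le; rewrite factor_degE mnm0E mnm1E subnK. Qed.

Lemma factor_deg_mnmP mon m : (forall i, factor_deg i mon = m) ->
  exists2 b, bounded m b & mon = mnm m b.
Proof.
move=> e; exists [ffun i => mon (mxi i 1)] => [i|].
  by rewrite ffunE -(e i) factor_degE leq_addl.
by apply: mnm_intro => i; rewrite ffunE // -(e i) factor_degE addnK.
Qed.

Lemma mnm_inj m m' b b' : (0 < d)%N -> bounded m b -> bounded m' b' ->
  mnm m b = mnm m' b' -> m = m' /\ b = b'.
Proof.
move=> d0 le le' e; split.
  by rewrite -(factor_deg_mnm (Ordinal d0) le) e factor_deg_mnm.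
by apply/ffunP => i; have := congr1 (fun mon => mon (mxi i 1)) e; rewrite !mnm1E.
Qed.

Lemma mdeg_factor mon i : (factor_deg i mon <= mdeg mon)%N.
Proof.
have -> : mdeg mon = (\sum_i factor_deg i mon)%N.
  rewrite mdegE pair_big /= (reindex _ (curry_mxvec_bij d 2)) /=.
  by apply: eq_bigr => -[].
by rewrite (bigD1 i) //= leq_addr.
Qed.

(** * The rings *)

(** The monomials that occur in A. *)
Definition balanced mon := exists m b, bounded m b /\ mon = mnm m b.

Lemma balanced_perm mon s : balanced (mperm mon s) <-> balanced mon.
Proof.
suff H u t : balanced u -> balanced (mperm u t).
  by split=> [/(H _ s^-1%g)|/(H _ s) //]; rewrite mpermK.
move=> [m [b [le ->]]]; exists m, (permf b t); rewrite mnm_permf.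
by split=> // c; rewrite ffunE.
Qed.

Lemma A_ringP (d_gt0 : (0 < d)%N) (p : S) :
  A_ring p <-> forall mon, p@_mon != 0 -> balanced mon.
Proof.
split=> [[n [f [fA ->]]] mon|bal].
  rewrite raddf_sum /= => /sum_neq0[m _ fm].
  rewrite -mcoeff_msupp in fm; have := fA m _ fm.
  by move/factor_deg_mnmP => [b le e]; exists m, b.
pose i0 := Ordinal d_gt0.
exists (msize p), (fun m =>
  \sum_(mon <- msupp p | factor_deg i0 mon == m) p@_mon *: 'X_[mon]).
split=> [m mon|].
  rewrite mcoeff_msupp raddf_sum /= => ne i.
  have /hasP[mon' supp /andP[/eqP dm]] :
      has (fun mon' => (factor_deg i0 mon' == m) && (mon' == mon)) (msupp p).
    apply: contraNT ne => /hasPn no; rewrite big1_seq // => mon' /andP[dm supp].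
    have := no _ supp; rewrite dm /= => /negbTE ne'.
    by rewrite mcoeffZ mcoeffX ne' mulr0.
  move/eqP => e; rewrite -e mcoeff_msupp in supp *.
  have [m' [b [le em]]] := bal _ supp.
  by move: dm; rewrite em !factor_deg_mnm.
rewrite (exchange_big_dep xpredT) //= [LHS]mpolyE; apply: eq_big_seq => mon supp.
have lt : (factor_deg i0 mon < msize p)%N.
  exact: leq_ltn_trans (mdeg_factor _ _) (msize_mdeg_lt supp).
by rewrite (big_pred1 (Ordinal lt)) // => m; rewrite /= eq_sym.
Qed.

Hypothesis d_gt0 : (0 < d)%N.

Lemma balanced_add mon mon' : balanced mon -> balanced mon' -> balanced (mon + mon')%MM.
Proof.
move=> [m [b [le ->]]] [m' [b' [le' ->]]]; rewrite mnm_fillD //.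
by exists (m + m')%N, [ffun c => b c + b' c]%N; split=> // c; rewrite ffunE leq_add.
Qed.

Lemma A_ringD (p q : S) : A_ring p -> A_ring q -> A_ring (p + q).
Proof.
move=> /(A_ringP d_gt0) Ap /(A_ringP d_gt0) Aq; apply/(A_ringP d_gt0) => mon.
rewrite mcoeffD; have [->|/Ap //] := eqVneq p@_mon 0.
by rewrite add0r => /Aq.
Qed.

Lemma A_ringZ a (p : S) : A_ring p -> A_ring (a *: p).
Proof.
move=> /(A_ringP d_gt0) Ap; apply/(A_ringP d_gt0) => mon.
by rewrite mcoeffZ mulf_eq0 negb_or => /andP[_ /Ap].
Qed.

Lemma A_ring0 : A_ring (0 : S).
Proof. by apply/(A_ringP d_gt0) => mon; rewrite mcoeff0 eqxx. Qed.

Lemma A_ring_sum (I : Type) (r : seq I) (P : pred I) (F : I -> S) :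
  (forall i, P i -> A_ring (F i)) -> A_ring (\sum_(i <- r | P i) F i).
Proof. by move=> h; elim/big_ind: _ => //; [apply: A_ring0 | apply: A_ringD]. Qed.

Lemma A_ringM (p q : S) : A_ring p -> A_ring q -> A_ring (p * q).
Proof.
move=> /(A_ringP d_gt0) Ap /(A_ringP d_gt0) Aq; apply/(A_ringP d_gt0) => mon.
rewrite -mcoeff_msupp => /msuppM_le/allpairsP[[m m'] /= [hm hm' ->]].
by rewrite !mcoeff_msupp in hm hm'; apply: balanced_add; [apply: Ap | apply: Aq].
Qed.

Lemma A_ring_perm_act s (p : S) : A_ring p -> A_ring (perm_act s p).
Proof.
move=> /(A_ringP d_gt0) Ap; apply/(A_ringP d_gt0) => mon.
by rewrite mcoeff_perm_act => /Ap/balanced_perm.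
Qed.

Lemma A_ringX m b : bounded m b -> A_ring ('X_[mnm m b] : S).
Proof.
move=> le; apply/(A_ringP d_gt0) => mon; rewrite mcoeffX.
by have [<- _|_] := eqVneq (mnm m b) mon; [exists m, b | rewrite eqxx].
Qed.

Lemma A_ring_gl_act_diag t (p : S) : A_ring p -> A_ring (gl_act (diag_mx t) p).
Proof.
move=> /(A_ringP d_gt0) Ap; apply/(A_ringP d_gt0) => mon.
by rewrite mcoeff_gl_act_diag mulf_eq0 negb_or => /andP[_ /Ap].
Qed.

Lemma A_ringC a : A_ring (a%:MP : S).
Proof.
apply/(A_ringP d_gt0) => mon; rewrite mcoeffC.
have [-> _|_] := eqVneq mon 0%MM; last by rewrite mulr0 eqxx.
exists 0%N, [ffun=> 0%N]; split=> [c|]; first by rewrite ffunE.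
by apply: mnm_intro => i; rewrite ?ffunE mnmE.
Qed.

Lemma B_ringD (p q : S) : B_ring p -> B_ring q -> B_ring (p + q).
Proof.
move=> [Ap ip] [Aq iq]; split=> [|s]; first exact: A_ringD.
by rewrite [LHS]raddfD /= [X in X + _]ip [X in _ + X]iq.
Qed.

Lemma B_ringZ a (p : S) : B_ring p -> B_ring (a *: p).
Proof. by move=> [Ap ip]; split=> [|s]; [apply: A_ringZ | rewrite perm_actZ ip]. Qed.

Lemma B_ringM (p q : S) : B_ring p -> B_ring q -> B_ring (p * q).
Proof.
by move=> [Ap ip] [Aq iq]; split=> [|s]; [apply: A_ringM | rewrite perm_actM ip iq].
Qed.

Lemma B_ringC a : B_ring (a%:MP : S).
Proof. by split=> [|s]; [apply: A_ringC | apply: comp_mpolyC]. Qed.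

Lemma B_ring_sum (I : Type) (r : seq I) (P : pred I) (F : I -> S) :
  (forall i, P i -> B_ring (F i)) -> B_ring (\sum_(i <- r | P i) F i).
Proof.
move=> h; elim/big_ind: _ => //; last exact: B_ringD.
by rewrite -mpolyC0; apply: B_ringC.
Qed.

Lemma torus_char_perm t mon s : torus_char t (mperm mon s) = torus_char t mon.
Proof.
apply: eq_bigr => j _; congr (_ ^+ _).
rewrite [RHS](reindex_inj (@perm_inj _ s)); apply: eq_bigr => i _.
exact: mpermE.
Qed.

Lemma perm_act_gl_act t s (p : S) :
  perm_act s (gl_act (diag_mx t) p) = gl_act (diag_mx t) (perm_act s p).
Proof.
apply/mpolyP => mon.
rewrite [LHS]mcoeff_perm_act [LHS]mcoeff_gl_act_diag torus_char_perm.
by rewrite [RHS]mcoeff_gl_act_diag mcoeff_perm_act.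
Qed.

Lemma B_ring_gl_act_diag t (p : S) : B_ring p -> B_ring (gl_act (diag_mx t) p).
Proof.
move=> [Ap ip]; split=> [|s]; first exact: A_ring_gl_act_diag.
by rewrite perm_act_gl_act ip.
Qed.

Lemma gl_act_const t (p : S) : (gl_act (diag_mx t) p)@_0%MM = p@_0%MM.
Proof.
rewrite mcoeff_gl_act_diag /torus_char big1 ?mul1r // => j _.
by rewrite big1 ?expr0 // => i _; rewrite mnmE.
Qed.

Lemma torus_char_mnm t m b : torus_char t (mnm m b) =
  t 0 0 ^+ (\sum_i (m - b i)) * t 0 1 ^+ (\sum_i b i).
Proof.
rewrite /torus_char big_ord_recr big_ord1 /=; congr (_ * _).
  have -> : widen_ord (leqnSn 1) ord0 = 0 by apply: val_inj.
  by congr (_ ^+ _); apply: eq_bigr => i _; rewrite mnm0E.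
have -> : ord_max = 1 :> 'I_2 by apply: val_inj.
by congr (_ ^+ _); apply: eq_bigr => i _; rewrite mnm1E.
Qed.

End Monomials.

(** * Covariants as translates *)

Section Specht.
Variables (k : fieldType) (d : nat) (la : seq nat).
Hypothesis char0 : [pchar k] =i pred0.
Local Notation S := (SymUd k d).
Local Notation gix := (gring_index [set: 'S_d]).
Local Notation rG := (regular_repr k [set: 'S_d]).
Local Notation W := (specht_mx k d la).
Local Notation c_la := (young_symmetrizer k d la).
Implicit Types (f : S) (s : 'S_d) (v : 'rV[k]_#|[set: 'S_d]|) (phi : covector k d la).

Lemma sum_gring (V : nmodType) (F : 'I_#|[set: 'S_d]| -> V) :
  \sum_i F i = \sum_(s : 'S_d) F (gix s).
Proof.
by rewrite (reindex gix) //; exists (fun i => enum_val i) => x _;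
  rewrite ?gring_valK ?gring_indexK ?inE.
Qed.

Lemma gring_index_eq s t : (gix s == gix t) = (s == t).
Proof. by rewrite (inj_in_eq (can_in_inj (@gring_indexK _ _))) ?inE. Qed.

(** The right action of the group algebra, in the coordinates of the regular
    representation. *)
Definition galg_act v f : S := \sum_(s : 'S_d) v 0 (gix s) *: perm_act s f.

Lemma galg_act_delta s f : galg_act (delta_mx 0 (gix s)) f = perm_act s f.
Proof.
rewrite /galg_act (bigD1 s) //= mxE !eqxx scale1r big1 ?addr0 // => t ts.
by rewrite mxE gring_index_eq (negbTE ts) andbF scale0r.
Qed.

Lemma galg_act_suml I (r : seq I) P (F : I -> 'rV[k]_#|[set: 'S_d]|) f :
  galg_act (\sum_(i <- r | P i) F i) f = \sum_(i <- r | P i) galg_act (F i) f.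
Proof.
rewrite exchange_big /=; apply: eq_bigr => s _.
by rewrite summxE scaler_suml.
Qed.

Lemma galg_act_scalel a v f : galg_act (a *: v) f = a *: galg_act v f.
Proof. by rewrite scaler_sumr; apply: eq_bigr => s _; rewrite mxE scalerA. Qed.

Lemma galg_act_mulmx m (u : 'rV[k]_m) (M : 'M_(m, #|[set: 'S_d]|)) f :
  galg_act (u *m M) f = \sum_i u 0 i *: galg_act (row i M) f.
Proof.
by rewrite mulmx_sum_row galg_act_suml; apply: eq_bigr => i _; rewrite galg_act_scalel.
Qed.

Lemma galg_act_sumr v I (r : seq I) P (F : I -> S) :
  galg_act v (\sum_(i <- r | P i) F i) = \sum_(i <- r | P i) galg_act v (F i).
Proof.
rewrite exchange_big /=; apply: eq_bigr => s _.
by rewrite perm_act_sum scaler_sumr.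
Qed.

Lemma galg_act_scaler v a f : galg_act v (a *: f) = a *: galg_act v f.
Proof.
by rewrite scaler_sumr; apply: eq_bigr => s _; rewrite perm_actZ !scalerA mulrC.
Qed.

Lemma galg_actB v f g : galg_act v (f - g) = galg_act v f - galg_act v g.
Proof.
by rewrite -sumrB; apply: eq_bigr => s _; rewrite perm_actB scalerBr.
Qed.

Lemma galg_act_mulr v b f : (forall s, perm_act s b = b) ->
  galg_act v (b * f) = b * galg_act v f.
Proof.
move=> inv; rewrite mulr_sumr; apply: eq_bigr => s _.
by rewrite perm_actM inv -scalerAr.
Qed.

Lemma galg_act_regular v s f : galg_act (v *m rG s) f = perm_act s (galg_act v f).
Proof.
rewrite galg_act_mulmx sum_gring perm_act_sum; apply: eq_bigr => t _.
by rewrite rowK gring_indexK ?inE // galg_act_delta perm_actZ perm_act_comp.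
Qed.

Lemma galg_act_young f : galg_act c_la f =
  \sum_(p in row_stab d la) \sum_(q in col_stab d la) (-1) ^+ q *: perm_act (p * q) f.
Proof.
rewrite galg_act_suml; apply: eq_bigr => p _.
rewrite galg_act_suml; apply: eq_bigr => q _.
by rewrite galg_act_scalel galg_act_delta.
Qed.

Lemma mcoeff_galg_act_young f m b : (galg_act c_la f)@_(mnm m b) =
  young_sum la (fun a => f@_(mnm m a)) b.
Proof.
rewrite galg_act_young raddf_sum; apply: eq_bigr => p _.
rewrite raddf_sum; apply: eq_bigr => q _ /=.
by rewrite mcoeffZ mcoeff_perm_act mnm_permf.
Qed.

Lemma mulmx_regular v s :
  v *m rG s = \sum_(t : 'S_d) v 0 (gix t) *: delta_mx 0 (gix (t * s)).
Proof.
rewrite mulmx_sum_row sum_gring; apply: eq_bigr => t _.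
by rewrite rowK gring_indexK ?inE.
Qed.

Definition specht_basis : 'M[k]_(specht_dim k d la, #|[set: 'S_d]|) :=
  val_submod (1%:M : 'M_(\rank W)).

(** The covariant v |-> f.v, evaluated on a basis of the Specht module. *)
Definition translate f : covector k d la := \col_x galg_act (row x specht_basis) f.

Lemma translate_sum I (r : seq I) P (F : I -> S) :
  translate (\sum_(i <- r | P i) F i) = \sum_(i <- r | P i) translate (F i).
Proof.
by apply/colP => x; rewrite summxE !mxE galg_act_sumr; apply: eq_bigr => i _; rewrite mxE.
Qed.

Lemma translateB f g : translate (f - g) = translate f - translate g.
Proof.
by apply/colP => x; rewrite !mxE galg_actB.
Qed.

Lemma translate_mul b f : (forall s, perm_act s b = b) ->
  translate (b * f) = b *: translate f.
Proof. by move=> inv; apply/colP => x; rewrite !mxE galg_act_mulr. Qed.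

Lemma translate_equivariant f : equivariant (translate f).
Proof.
move=> s; apply/colP => x; rewrite !mxE -galg_act_regular.
have -> : row x specht_basis *m rG s = row x (specht_repr k d la s) *m specht_basis.
  rewrite -!row_mul /specht_basis -val_submodE.
  by rewrite -(val_submodJ (cyclic_mx_module rG c_la)) ?inE // mul1mx.
rewrite galg_act_mulmx; apply: eq_bigr => y _.
by rewrite !mxE mul_mpolyC.
Qed.

(** The Young symmetrizer generates the Specht module. *)
Lemma translate_eq0 f : translate f = 0 <-> galg_act c_la f = 0.
Proof.
split=> [t0|c0].
  have -> : c_la = in_submod W c_la *m specht_basis.
    by rewrite -val_submodE in_submodK // cyclic_mx_id.
  rewrite galg_act_mulmx big1 // => x _.
  by have /colP/(_ x) := t0; rewrite !mxE => ->; rewrite scaler0.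
apply/colP => x; rewrite !mxE.
have : (row x specht_basis <= W)%MS.
  by apply: submx_trans (row_sub _ _) _; apply: val_submodP.
case/cyclic_mxP => A /envelop_mxP[a ->] ->.
rewrite mulmx_sumr galg_act_suml big1 // => s _.
by rewrite -scalemxAr galg_act_scalel galg_act_regular c0 perm_act0 scaler0.
Qed.

(** [in_submod] is defined on the whole group algebra, so this is a linear
    extension of [phi]; averaging will make it equivariant. *)
Definition extend phi v : S := \sum_x in_submod W v 0 x *: phi x 0.

Lemma extend_basis phi x : extend phi (row x specht_basis) = phi x 0.
Proof.
rewrite /extend /specht_basis rowE -val_submodE val_submodK (bigD1 x) //= mxE !eqxx.
by rewrite scale1r big1 ?addr0 // => y yx; rewrite mxE (negbTE yx) andbF scale0r.
Qed.

Lemma extend_sum phi I (r : seq I) P (F : I -> 'rV[k]_#|[set: 'S_d]|) :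
  extend phi (\sum_(i <- r | P i) F i) = \sum_(i <- r | P i) extend phi (F i).
Proof.
rewrite exchange_big /=; apply: eq_bigr => x _.
by rewrite raddf_sum summxE scaler_suml.
Qed.

Lemma extend_scale phi a v : extend phi (a *: v) = a *: extend phi v.
Proof. by rewrite scaler_sumr; apply: eq_bigr => x _; rewrite linearZ mxE scalerA. Qed.

Lemma extend_regular phi v s : equivariant phi -> (v <= W)%MS ->
  extend phi (v *m rG s) = perm_act s (extend phi v).
Proof.
move=> eqv vW; rewrite /extend perm_act_sum.
have -> : in_submod W (v *m rG s) = in_submod W v *m specht_repr k d la s.
  by rewrite -(in_submodJ (cyclic_mx_module rG c_la)) ?inE.
under eq_bigr do rewrite mxE scaler_suml; rewrite exchange_big /=.
apply: eq_bigr => y _; rewrite perm_actZ.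
have /colP/(_ y) := eqv s; rewrite mxE [X in _ = X -> _]mxE => ->.
rewrite scaler_sumr; apply: eq_bigr => x _.
by rewrite [map_mx _ _ _ _]mxE mul_mpolyC scalerA.
Qed.

(** The value at the identity of the average of [extend phi] over the
    group. *)
Definition average phi : S := (d`!%:R)^-1 *:
  \sum_(s : 'S_d) perm_act s (extend phi (delta_mx 0 (gix s^-1%g))).

Lemma fact_neq0 : d`!%:R != 0 :> k.
Proof. by rewrite natr_eq0_char0 // -lt0n fact_gt0. Qed.

Lemma translate_average phi : equivariant phi -> translate (average phi) = phi.
Proof.
move=> eqv; apply/colP => x; rewrite mxE; set v := row x specht_basis.
have vW : (v <= W)%MS.
  by apply: submx_trans (row_sub _ _) _; apply: val_submodP.
have Ev s : perm_act s (extend phi (v *m rG s^-1%g)) = extend phi v.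
  by rewrite extend_regular // perm_act_comp mulVg perm_act1.
rewrite /average galg_act_scaler galg_act_sumr -[RHS]extend_basis -/v.
have -> : \sum_s galg_act v (perm_act s (extend phi (delta_mx 0 (gix s^-1%g)))) =
    \sum_s perm_act s (extend phi (v *m rG s^-1%g)).
  under [RHS]eq_bigr do rewrite mulmx_regular extend_sum perm_act_sum.
  rewrite exchange_big [RHS]exchange_big /=; apply: eq_bigr => t _.
  rewrite (reindex_inj (mulIg t^-1)%g); apply: eq_bigr => s _.
  by rewrite perm_act_comp mulgKV invMg invgK extend_scale perm_actZ.
under eq_bigr do rewrite Ev.
by rewrite sumr_const card_Sn -scaler_nat scalerA mulVf ?fact_neq0 // scale1r.
Qed.

End Specht.

(** * Triangular systems *)

Section Triangular.
Variables (k : fieldType) (I : finType) (key : I -> nat) (M : I -> I -> k).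
Hypothesis M_tri : forall i j, M i j != 0 -> i = j \/ (key j < key i)%N.
Hypothesis M_diag : forall i, M i i != 0.

Lemma triangular_free (x : I -> k) :
  (forall j, \sum_i x i * M i j = 0) -> forall i, x i = 0.
Proof.
move=> xM i0; apply/eqP/negPn/negP => ne0.
case: (@arg_maxnP _ i0 (fun i => x i != 0) key ne0) => i xi max_i.
have := xM i; rewrite (bigD1 i) //= big1 ?addr0 => [/eqP|j ji].
  by rewrite mulf_eq0 (negbTE xi) (negbTE (M_diag i)).
apply/eqP; rewrite mulf_eq0; apply: contraNT ji; rewrite negb_or => /andP[xj Mji].
case: (M_tri Mji) => [-> //|lt].
by have := max_i _ xj; rewrite /= leqNgt lt.
Qed.

(** Induction on the largest key in the support of the right hand side. *)
Lemma triangular_solve (w : I -> k) : exists x, forall j, \sum_i x i * M i j = w j.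
Proof.
suff H n (v : I -> k) : (forall j, v j != 0 -> (key j < n)%N) ->
    exists x, forall j, \sum_i x i * M i j = v j.
  by apply: (H (\max_j key j).+1) => j _; rewrite ltnS leq_bigmax.
elim: n v => [|n IH] v vn.
  exists (fun=> 0) => j; rewrite big1 => [|i _]; last by rewrite mul0r.
  by apply/eqP; rewrite eq_sym; apply/negPn/negP => /vn.
pose y i := if key i == n then v i / M i i else 0.
have [|x xE] := IH (fun j => v j - \sum_i y i * M i j).
  move=> j ne; rewrite ltnNge; apply: contraNN ne => le.
  rewrite (bigD1 j) //= big1 ?addr0 => [|i ij].
    rewrite /y; case: ifPn => [_|nj]; first by rewrite divfK // subrr.
    rewrite mul0r subr0; apply/negPn/negP => /vn; rewrite ltnS => le'.
    by case/eqP: nj; apply/eqP; rewrite eqn_leq le le'.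
  rewrite /y; case: eqP => [ei|_]; last by rewrite mul0r.
  apply/eqP; rewrite mulf_eq0; apply/orP; right; apply: contraNT ij => Mij.
  by case: (M_tri Mij) => [->|]; rewrite // ei ltnNge le.
exists (fun i => x i + y i) => j.
by under eq_bigr do rewrite mulrDl; rewrite big_split /= xE subrK.
Qed.

End Triangular.

(** * A basis of the covariants *)

Section Basis.
Variables (k : fieldType) (d : nat) (la : seq nat).
Hypothesis char0 : [pchar k] =i pred0.
Hypothesis d_gt0 : (0 < d)%N.
Hypothesis la_d : is_partition d la.
Local Notation S := (SymUd k d).
Local Notation c_la := (young_symmetrizer k d la).
Implicit Types (f : S) (s p q : 'S_d) (b a mu : filling d) (T : SYT d la).

(** Straightening, applied in each degree separately. *)
Lemma galg_act_young_eq0 f : A_ring f ->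
    (forall m b, bounded m b -> semistandard la b -> (galg_act c_la f)@_(mnm m b) = 0) ->
  galg_act c_la f = 0.
Proof.
move=> /A_ringP-/(_ d_gt0) Af f0; apply/mpolyP => mon; rewrite mcoeff0.
apply/eqP/negPn/negP => ne; have bal : balanced mon.
  move: ne; rewrite galg_act_young raddf_sum => /sum_neq0[p _] /=.
  rewrite raddf_sum => /sum_neq0[q _] /=.
  rewrite mcoeffZ mcoeff_perm_act mulf_eq0 negb_or => /andP[_ /Af].
  by move/balanced_perm.
case: bal ne => m [b [le ->]]; rewrite mcoeff_galg_act_young => /eqP; apply.
apply: (straightening char0 la_d (m := m)) => // a lea sa.
by rewrite -mcoeff_galg_act_young f0.
Qed.

Definition orbit_sum r mu : S := \sum_(s : 'S_d) 'X_[mnm r (permf mu s)].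

Lemma orbit_sum_inv r mu t : perm_act t (orbit_sum r mu) = orbit_sum r mu.
Proof.
rewrite perm_act_sum (reindex_inj (mulgI t)); apply: eq_bigr => s _ /=.
by rewrite perm_actX -mnm_permf permfM mulKg.
Qed.

Lemma orbit_sum_supp r mu mon : bounded r mu -> (orbit_sum r mu)@_mon != 0 ->
  exists s, mon = mnm r (permf mu s).
Proof.
move=> le; rewrite raddf_sum => /sum_neq0[s _] /=; rewrite mcoeffX => ne.
by exists s; apply/esym/eqP; apply: contraNT ne => /negbTE ->.
Qed.

Lemma orbit_sum_B r mu : bounded r mu -> B_ring (orbit_sum r mu).
Proof.
move=> le; split=> [|t]; last exact: orbit_sum_inv.
apply/A_ringP => // mon /(orbit_sum_supp le)[s ->].
by exists r, (permf mu s); split=> //; apply: bounded_permf.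
Qed.

Lemma orbit_sum_perm r mu s : orbit_sum r (permf mu s) = orbit_sum r mu.
Proof.
rewrite /orbit_sum [RHS](reindex_inj (mulIg s)).
by apply: eq_bigr => t _; rewrite permfM.
Qed.

(** A rearrangement maximizing [\sum_i i * mu (s i)] is sorted. *)
Lemma sort_filling mu : exists s, monotone (permf mu s).
Proof.
case: (@arg_maxnP _ (1%g : 'S_d) predT
  (fun s : 'S_d => \sum_(i < d) i * permf mu s i)%N isT) => s _ max_s.
exists s; apply/monotoneP => i j; rewrite leq_eqVlt => /orP[/eqP/val_inj -> //|lt].
rewrite leqNgt; apply/negP => gt.
have := tperm_gain (al := @nat_of_ord d) lt gt.
rewrite ltnNge; case/negP; have := max_s (tperm i j * s)%g isT.
rewrite /= => /(leq_trans _); apply; apply/eq_leq/eq_bigr => x _.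
by rewrite -permfM [in RHS]ffunE.
Qed.

Definition desc_monomial T : S := 'X_[mnm (des T) (desc_filling T)].

Lemma desc_filling_bounded T : bounded (des T) (desc_filling T).
Proof. by move=> c; apply: desc_filling_le. Qed.

Section Index.
Variable N : nat.

(** The pairs (T, mu) are indexed together with the degree m of the product
    they give; bounding m by [N] makes the index set finite. *)
Definition ffun_filling (mu : {ffun 'I_d -> 'I_N}) : filling d :=
  [ffun c => nat_of_ord (mu c)].

Definition valid_std_index (x : SYT d la * ('I_N * {ffun 'I_d -> 'I_N})) :=
  let mu := ffun_filling x.2.2 in
  [&& (des x.1 <= x.2.1)%N, monotone mu & [forall c, mu c <= x.2.1 - des x.1]%N].

Definition std_index := {x | valid_std_index x}.

Definition idx_tab (i : std_index) : SYT d la := (val i).1.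
Definition idx_deg (i : std_index) : nat := (val i).2.1.
Definition idx_mu (i : std_index) : filling d := ffun_filling (val i).2.2.
Definition idx_fill (i : std_index) := std_filling (idx_tab i) (idx_mu i).

Lemma idx_des i : (des (idx_tab i) <= idx_deg i)%N.
Proof. by case/and3P: (valP i). Qed.

Lemma idx_mono i : monotone (idx_mu i).
Proof. by case/and3P: (valP i). Qed.

Lemma idx_bounded i : bounded (idx_deg i - des (idx_tab i)) (idx_mu i).
Proof. by case/and3P: (valP i) => _ _ /forallP. Qed.

Lemma idx_exists T m mu : (m < N)%N -> (des T <= m)%N -> monotone mu ->
    bounded (m - des T) mu ->
  exists i, [/\ idx_tab i = T, idx_deg i = m & idx_mu i = mu].
Proof.
move=> ltm leT mono le.
have lt c : (mu c < N)%N.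
  by apply: leq_ltn_trans ltm; apply: leq_trans (le c) (leq_subr _ _).
pose x : SYT d la * ('I_N * {ffun 'I_d -> 'I_N}) :=
  (T, (Ordinal ltm, [ffun c => Ordinal (lt c)])).
have muE : ffun_filling x.2.2 = mu by apply/ffunP => c; rewrite !ffunE.
have vx : valid_std_index x by rewrite /valid_std_index muE leT mono; apply/forallP.
by exists (Sub x vx); rewrite /idx_tab /idx_deg /idx_mu SubK.
Qed.

Lemma idx_inj i j : idx_deg i = idx_deg j -> idx_fill i = idx_fill j -> i = j.
Proof.
move=> ed /(std_filling_inj la_d (idx_mono i) (idx_mono j))[eT emu].
apply: val_inj; case: i j ed eT emu => [[T [m mu]] vi] [[T' [m' mu']] vj].
rewrite /idx_deg /idx_tab /idx_mu /= => /val_inj -> -> emu; congr (_, (_, _)).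
by apply/ffunP => c; apply: val_inj; have /ffunP/(_ c) := emu; rewrite !ffunE.
Qed.

Lemma std_filling_boundedP T mu m : (des T <= m)%N -> bounded (m - des T) mu ->
  bounded m (std_filling T mu).
Proof.
move=> leT le c; rewrite ffunE -(subnKC leT) leq_add //.
exact: desc_filling_bounded.
Qed.

Lemma idx_fill_bounded i : bounded (idx_deg i) (idx_fill i).
Proof. exact: std_filling_boundedP (idx_des i) (@idx_bounded i). Qed.

Definition idx_sum i : S := orbit_sum (idx_deg i - des (idx_tab i)) (idx_mu i).
Definition idx_poly i : S := idx_sum i * desc_monomial (idx_tab i).

Definition idx_translate i s : filling d :=
  [ffun c => desc_filling (idx_tab i) c + permf (idx_mu i) s c]%N.

Lemma idx_translate_bounded i s : bounded (idx_deg i) (idx_translate i s).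
Proof.
move=> c; rewrite ffunE -(subnKC (idx_des i)) leq_add //.
  exact: desc_filling_bounded.
by rewrite ffunE idx_bounded.
Qed.

Lemma idx_polyE i : idx_poly i = \sum_(s : 'S_d) 'X_[mnm (idx_deg i) (idx_translate i s)].
Proof.
rewrite /idx_poly /idx_sum /orbit_sum mulr_suml; apply: eq_bigr => s _.
rewrite -mpolyXD mnm_fillD.
- rewrite subnK ?idx_des //; congr 'X_[mnm _ _].
  by apply/ffunP => c; rewrite !ffunE addnC.
- exact/bounded_permf/idx_bounded.
- exact: desc_filling_bounded.
Qed.

Lemma idx_poly_coef i m b : (idx_poly i)@_(mnm m b) =
  (#|[set s | mnm (idx_deg i) (idx_translate i s) == mnm m b]|)%:R.
Proof.
rewrite idx_polyE raddf_sum -sum1dep_card natr_sum [RHS]big_mkcond /=.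
by apply: eq_bigr => s _; rewrite mcoeffX; case: eqP.
Qed.

Lemma idx_poly_coef_neq0 i m b : bounded m b -> (idx_poly i)@_(mnm m b) != 0 ->
  idx_deg i = m /\ exists s, b = idx_translate i s.
Proof.
move=> le; rewrite idx_poly_coef natr_eq0_char0 // cards_eq0 => /set0Pn[s].
rewrite inE => /eqP/(mnm_inj d_gt0 (@idx_translate_bounded i s) le)[-> <-].
by split=> //; exists s.
Qed.

Definition idx_matrix (i j : std_index) : k :=
  (galg_act c_la (idx_poly i))@_(mnm (idx_deg j) (idx_fill j)).

(** The terms of the Young sum that contribute to a diagonal coefficient all
    have trivial column permutation, so they carry the sign +1. *)
Lemma idx_term i j p q : p \in row_stab d la -> q \in col_stab d la ->
    (idx_poly i)@_(mnm (idx_deg j) (permf (idx_fill j) (p * q))) != 0 ->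
  (i = j \/ (energy la (idx_fill j) < energy la (idx_fill i))%N) /\ (i = j -> q = 1%g).
Proof.
move=> Rp Cq; case/idx_poly_coef_neq0 => [|ed [s def]].
  exact/bounded_permf/idx_fill_bounded.
have sstd := std_filling_semistandard la_d (idx_tab j) (idx_mono j).
have [le eq] := energy_std_filling la_d (idx_mono i) sstd Rp Cq def.
move: le; rewrite leq_eqVlt => /orP[/eqP e|lt].
  by have [q1 ef] := eq e; split=> //; left; apply: idx_inj.
split; [by right | by move=> eij; rewrite eij ltnn in lt].
Qed.

Lemma idx_matrix_tri i j : idx_matrix i j != 0 ->
  i = j \/ (energy la (idx_fill j) < energy la (idx_fill i))%N.
Proof.
rewrite /idx_matrix mcoeff_galg_act_young => /young_sum_neq0[p [q [Rp Cq]]].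
by case/(idx_term Rp Cq).
Qed.

(** A diagonal coefficient is a number of triples (p, q, s), at least one of
    which is (1, 1, T): it is nonzero in characteristic zero. *)
Lemma idx_matrix_diag i : idx_matrix i i != 0.
Proof.
rewrite /idx_matrix mcoeff_galg_act_young /young_sum.
pose n p q := #|[set s | mnm (idx_deg i) (idx_translate i s) ==
  mnm (idx_deg i) (permf (idx_fill i) (p * q))]|.
have -> : \sum_(p in row_stab d la) \sum_(q in col_stab d la)
    (-1) ^+ q * (idx_poly i)@_(mnm (idx_deg i) (permf (idx_fill i) (p * q))) =
    (\sum_(p in row_stab d la) \sum_(q in col_stab d la) n p q)%:R :> k.
  rewrite natr_sum; apply: eq_bigr => p Rp; rewrite natr_sum; apply: eq_bigr => q Cq.
  have := @idx_term i i p q Rp Cq; rewrite idx_poly_coef -/(n p q).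
  have [-> _|_ /(_ isT)[_ ->//]] := eqVneq (n p q)%:R 0; first by rewrite mulr0.
  by rewrite odd_perm1 mul1r.
have R1 : 1%g \in row_stab d la by apply/row_stabP => c; rewrite perm1.
have C1 : 1%g \in col_stab d la by apply/col_stabP => c; rewrite perm1.
rewrite natr_eq0_char0 // (bigD1 1%g) //= (bigD1 1%g) //= -lt0n addn_gt0.
apply/orP; left; rewrite addn_gt0; apply/orP; left.
rewrite card_gt0; apply/set0Pn; exists (syt_perm (idx_tab i)); rewrite inE mulg1 permf1.
by apply/eqP; congr mnm; apply/ffunP => c; rewrite !ffunE.
Qed.

End Index.

Lemma idx_sum_B N (i : std_index N) : B_ring (idx_sum i).
Proof. exact/orbit_sum_B/idx_bounded. Qed.

Lemma combination_by_tableau N (x : SYT d la -> std_index N -> k) :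
  \sum_T (\sum_(i | idx_tab i == T) x T i *: idx_sum i) * desc_monomial T =
  \sum_i x (idx_tab i) i *: idx_poly i.
Proof.
rewrite [RHS](partition_big (@idx_tab N) xpredT) //=; apply: eq_bigr => T _.
by rewrite mulr_suml; apply: eq_bigr => i /eqP <-; rewrite -scalerAl.
Qed.

(** The triangular system matches f with a combination of the products in all
    coefficients at semistandard fillings, hence by straightening as a
    covariant. *)
Lemma covariant_generation f : A_ring f -> exists b : SYT d la -> S,
  (forall T, B_ring (b T)) /\
  translate la f = \sum_T b T *: translate la (desc_monomial T).
Proof.
move=> Af; pose N := msize f.
have [x xE] := triangular_solve (@idx_matrix_tri N) (@idx_matrix_diag N)
  (fun j => (galg_act c_la f)@_(mnm (idx_deg j) (idx_fill j))).
pose b T := \sum_(i | idx_tab i == T) x i *: idx_sum i.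
have Bb T : B_ring (b T) by apply: B_ring_sum => // i _; apply/B_ringZ/idx_sum_B.
exists b; split=> //.
have -> : \sum_T b T *: translate la (desc_monomial T) =
    translate la (\sum_i x i *: idx_poly i).
  rewrite -(combination_by_tableau (fun=> x)) translate_sum; apply: eq_bigr => T _.
  by rewrite translate_mul //; case: (Bb T).
apply/eqP; rewrite -subr_eq0 -translateB; apply/eqP/translate_eq0.
set g := f - _; have Ag : A_ring g.
  rewrite /g -scaleN1r; apply: A_ringD => //; apply: A_ringZ => //.
  apply: A_ring_sum => // i _; apply: A_ringZ => //; apply: A_ringM => //.
    by case: (idx_sum_B i).
  by apply: A_ringX => //; apply: desc_filling_bounded.
have coef_h m a : (\sum_i x i *: idx_poly i)@_(mnm m a) =
    \sum_i x i * (idx_poly i)@_(mnm m a).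
  by rewrite raddf_sum; apply: eq_bigr => i _; rewrite /= mcoeffZ.
have galg_act_h : galg_act c_la (\sum_i x i *: idx_poly i) =
    \sum_i x i *: galg_act c_la (idx_poly i).
  by rewrite galg_act_sumr; apply: eq_bigr => i _; rewrite galg_act_scaler.
apply: galg_act_young_eq0 => // m a lea sa.
(* Beyond the degree of f there is nothing to check; below it, a is the filling
   of some index. *)
have [ltm|lem] := ltnP m N; last first.
  rewrite mcoeff_galg_act_young /young_sum big1 // => p _; rewrite big1 // => q _.
  have leb := bounded_permf (p * q) lea.
  suff -> : g@_(mnm m (permf a (p * q))) = 0 by rewrite mulr0.
  rewrite mcoeffB coef_h big1 ?subr0 => [|i _]; last first.
    apply/eqP; rewrite mulf_eq0; apply/orP; right; apply/negPn/negP.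
    case/(idx_poly_coef_neq0 leb) => e _; move: lem.
    by rewrite -e leqNgt ltn_ord.
  apply/eqP/negPn/negP; rewrite -mcoeff_msupp => /msize_mdeg_lt.
  rewrite ltnNge; apply/negP; rewrite negbK; apply: leq_trans lem _.
  by rewrite -{1}(factor_deg_mnm (Ordinal d_gt0) leb) mdeg_factor.
have [T [mu [mono def]]] := standardization la_d sa.
have [leT lemu] : (des T <= m)%N /\ bounded (m - des T) mu.
  by apply: std_filling_bound => // c; rewrite -def lea.
have [j [eT em emu]] := idx_exists ltm leT mono lemu.
have -> : galg_act c_la g = galg_act c_la f - \sum_i x i *: galg_act c_la (idx_poly i).
  by rewrite -galg_act_h -galg_actB.
rewrite mcoeffB; apply/eqP; rewrite subr_eq0; apply/eqP.
have := xE j; rewrite /idx_fill em eT emu -def => <-.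
rewrite [RHS]raddf_sum; apply: eq_bigr => i _; rewrite /= mcoeffZ.
by rewrite /idx_matrix /idx_fill em eT emu -def.
Qed.

(** An invariant polynomial is its own average, and each of its monomials can
    be sorted before averaging.  The tableau only shifts the degree. *)
Lemma B_ring_expand N T (b : S) : B_ring b -> (msize b + des T <= N)%N ->
  exists x : std_index N -> k, b = \sum_(i | idx_tab i == T) x i *: idx_sum i.
Proof.
move=> [Ab ib] leN.
pose P (g : S) := exists x : std_index N -> k,
  g = \sum_(i | idx_tab i == T) x i *: idx_sum i.
have PZ (a : k) g : P g -> P (a *: g).
  move=> [x ->]; exists (fun i => a * x i); rewrite scaler_sumr.
  by apply: eq_bigr => i _; rewrite scalerA.
have eb : b = (d`!%:R)^-1 *:
    \sum_(mon <- msupp b) b@_mon *: \sum_(s : 'S_d) 'X_[mperm mon s].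
  have -> : \sum_(mon <- msupp b) b@_mon *: \sum_(s : 'S_d) 'X_[mperm mon s] =
      \sum_(s : 'S_d) perm_act s b.
    rewrite [RHS](reindex_inj invg_inj) /=.
    under [RHS]eq_bigr do rewrite [b in perm_act _ b]mpolyE perm_act_sum.
    rewrite [RHS]exchange_big /=; apply: eq_bigr => mon _; rewrite scaler_sumr.
    by apply: eq_bigr => s _; rewrite perm_actZ perm_actX invgK.
  under eq_bigr do rewrite ib.
  by rewrite sumr_const card_Sn -scaler_nat scalerA mulVf ?fact_neq0 // scale1r.
rewrite eb; apply/PZ; rewrite big_seq.
apply: (big_ind P) => [|g h [x ->] [y ->]|mon supp].
- by exists (fun=> 0); rewrite big1 // => i _; rewrite scale0r.
- exists (fun i => x i + y i); rewrite -big_split; apply: eq_bigr => i _.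
  by rewrite scalerDl.
apply: PZ; have [r [b0 [le0 emon]]] : balanced mon.
  by move/(A_ringP d_gt0): Ab; apply; rewrite -mcoeff_msupp.
have [s mono] := sort_filling b0.
have [|||i [eT em emu]] := @idx_exists N T (r + des T) (permf b0 s) _ _ mono.
- apply: leq_trans leN; rewrite ltn_add2r; apply: leq_ltn_trans (msize_mdeg_lt supp).
  by rewrite -(factor_deg_mnm (Ordinal d_gt0) le0) -emon mdeg_factor.
- exact: leq_addl.
- by rewrite addnK; apply: bounded_permf.
exists (fun j => (j == i)%:R).
rewrite (bigD1 i) ?eT //= eqxx scale1r [X in _ + X]big1 ?addr0.
  rewrite /idx_sum em eT emu addnK orbit_sum_perm emon /orbit_sum.
  by apply: eq_bigr => t _; rewrite mnm_permf.
by move=> j /andP[_ /negbTE ->]; rewrite scale0r.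
Qed.

(** Expanding the coefficients in orbit sums turns a relation over B into a
    relation over [k] between the products, which are independent. *)
Lemma covariant_free (b : SYT d la -> S) : (forall T, B_ring (b T)) ->
  \sum_T b T *: translate la (desc_monomial T) = 0 -> forall T, b T = 0.
Proof.
move=> Bb rel; pose N := \max_T (msize (b T) + des T)%N.
have /fin_all_exists[x xE] T : exists x : std_index N -> k,
    b T = \sum_(i | idx_tab i == T) x i *: idx_sum i.
  by apply: B_ring_expand => //; apply: (leq_bigmax T).
have {}rel : galg_act c_la (\sum_i x (idx_tab i) i *: idx_poly i) = 0.
  apply/translate_eq0; rewrite -combination_by_tableau translate_sum -[RHS]rel.
  apply: eq_bigr => T _; rewrite -xE translate_mul //; by case: (Bb T).
have x0 : forall i, x (idx_tab i) i = 0.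
  apply: (triangular_free (@idx_matrix_tri N) (@idx_matrix_diag N)) => j.
  have := congr1 (mcoeff (mnm (idx_deg j) (idx_fill j))) rel.
  rewrite galg_act_sumr raddf_sum mcoeff0 /= => e; rewrite -[RHS]e.
  by apply: eq_bigr => i _; rewrite galg_act_scaler mcoeffZ.
by move=> T; rewrite xE big1 // => i /eqP <-; rewrite x0 scale0r.
Qed.

End Basis.

(** * Generators and the character of the fibre *)

Section Generators.
Variables (k : fieldType) (d : nat) (la : seq nat).
Hypothesis char0 : [pchar k] =i pred0.
Hypothesis d_gt0 : (0 < d)%N.
Hypothesis la_d : is_partition d la.
Local Notation S := (SymUd k d).
Implicit Types (f : S) (T : SYT d la) (phi : covector k d la).

Definition generator T : covector k d la := translate la (desc_monomial k T).

Lemma M_deg_mod m phi : M_deg m phi -> M_mod phi.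
Proof.
move=> [eqv deg]; split=> // x; apply/(A_ringP d_gt0) => mon.
rewrite -mcoeff_msupp => /deg/factor_deg_mnmP[b le ->]; by exists m, b.
Qed.

Lemma gen_deg T : M_deg (des T) (generator T).
Proof.
split=> [|x mon]; first exact: translate_equivariant.
rewrite mxE mcoeff_msupp raddf_sum => /sum_neq0[s _] /= ne i.
have e : mperm mon s = mnm (des T) (desc_filling T).
  apply/esym/eqP; apply: contraNT ne => /negbTE ne.
  by rewrite mcoeffZ mcoeff_perm_act mcoeffX ne mulr0.
have := factor_deg_perm mon s (s^-1%g i); rewrite permKV => <-.
by rewrite e factor_deg_mnm //; apply: desc_filling_bounded.
Qed.

Lemma gen_mod T : M_mod (generator T).
Proof. exact: M_deg_mod (gen_deg T). Qed.

Lemma gen_span phi : M_mod phi -> exists b : SYT d la -> S,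
  (forall T, B_ring (b T)) /\ phi = \sum_T b T *: generator T.
Proof.
move=> [eqv Aphi].
have [|b [Bb e]] := @covariant_generation _ _ _ char0 d_gt0 la_d (average phi).
  apply: A_ringZ => //; apply: A_ring_sum => // s _; apply: A_ring_perm_act => //.
  by apply: A_ring_sum => // x _; apply: A_ringZ.
by exists b; split=> //; rewrite -[LHS](translate_average char0 eqv).
Qed.

(** By freeness the coordinates of an element of B_+ M lie in B_+. *)
Lemma BplusM_coef0 (b : SYT d la -> S) : (forall T, B_ring (b T)) ->
  BplusM (\sum_T b T *: generator T) -> forall T, (b T)@_0%MM = 0.
Proof.
move=> Bb [n [c [m [cm e]]]] T.
have /fin_all_exists[a aE] x := gen_span (cm x).2.
have {}e : \sum_T (b T - \sum_x c x * a x T) *: generator T = 0.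
  under eq_bigr do rewrite scalerBl; rewrite sumrB e; apply/eqP; rewrite subr_eq0.
  apply/eqP; under [RHS]eq_bigr do rewrite scaler_suml.
  rewrite exchange_big; apply: eq_bigr => x _; rewrite [in LHS](aE x).2 scaler_sumr.
  by apply: eq_bigr => T' _; rewrite scalerA.
have Bd T' : B_ring (b T' - \sum_x c x * a x T').
  rewrite -scaleN1r; apply: B_ringD => //; apply: B_ringZ => //.
  apply: B_ring_sum => // x _; apply: B_ringM => //; last by case: (aE x).
  by case: (cm x) => -[].
have /eqP := covariant_free char0 d_gt0 la_d Bd e T; rewrite subr_eq0 => /eqP ->.
rewrite raddf_sum big1 // => x _ /=.
by rewrite rmorphM /=; case: (cm x) => -[_ ->]; rewrite mul0r.
Qed.

Lemma BplusM_sum (b : SYT d la -> S) : (forall T, B_plus (b T)) ->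
  BplusM (\sum_T b T *: generator T).
Proof.
move=> Bb; exists #|{: SYT d la}|, (fun x => b (enum_val x)).
exists (fun x => generator (enum_val x)).
split=> [x|]; first by split; [apply: Bb | apply: gen_mod].
by rewrite (reindex (@enum_val _ {: SYT d la})) //; apply: onW_bij; apply: enum_val_bij.
Qed.

Lemma gen_minimal : minimal_generators generator.
Proof.
split=> [T|phi /gen_span|T spans]; [exact: gen_mod | by [] |].
have [b [Bb e]] := spans _ (gen_mod T).
pose b' T' : S := if T' == T then (-1)%:MP else b T'.
have Bb' T' : B_ring (b' T') by rewrite /b'; case: eqP => // _; apply: B_ringC.
have : \sum_T' b' T' *: generator T' = 0.
  rewrite (bigD1 T) //= {1}/b' eqxx; apply/eqP; rewrite addrC addr_eq0; apply/eqP.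
  rewrite mpolyCN mpolyC1 scaleN1r opprK [RHS]e; apply: eq_bigr => T' /negbTE nT.
  by rewrite /b' nT.
move/(covariant_free char0 d_gt0 la_d Bb')/(_ T); rewrite /b' eqxx => /eqP.
by rewrite mpolyC_eq0 oppr_eq0 oner_eq0.
Qed.

Lemma maj_le T : (maj T <= d * des T)%N.
Proof. by rewrite -(desc_filling_sum T) leq_addl. Qed.

Lemma gl_act_translate t f :
  map_mx (gl_act (diag_mx t)) (translate la f) = translate la (gl_act (diag_mx t) f).
Proof.
apply/colP => x; rewrite !mxE gl_act_sum; apply: eq_bigr => s _.
by rewrite gl_actZ perm_act_gl_act.
Qed.

(** The exponents of [y] add up to d des T - maj T, as a descent j contributes
    to the d - j boxes with larger entries. *)
Lemma gl_act_generator t T : map_mx (gl_act (diag_mx t)) (generator T) =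
  (t 0 0 ^+ maj T * t 0 1 ^+ (d * des T - maj T))%:MP *: generator T.
Proof.
rewrite gl_act_translate; have -> : gl_act (diag_mx t) (desc_monomial k T) =
    (t 0 0 ^+ maj T * t 0 1 ^+ (d * des T - maj T))%:MP * desc_monomial k T.
  rewrite [LHS]gl_act_diagX mul_mpolyC; congr (_ *: _).
  rewrite -/(torus_char t _) torus_char_mnm.
  have e := desc_filling_sum T.
  congr (_ ^+ _ * _ ^+ _); last by rewrite -e addnK.
  apply/eqP; rewrite -(eqn_add2l (\sum_c desc_filling T c)) e -big_split /=.
  rewrite (eq_bigr (fun=> des T)) => [|c _]; last first.
    by rewrite subnKC // desc_filling_le.
  by rewrite sum_nat_const card_ord.
by rewrite translate_mul // => s; apply: comp_mpolyC.
Qed.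

Definition tor_index i a := [pred T : SYT d la | (des T == i) && (maj T == a)].

Lemma natr_inj_char0 m n : m%:R = n%:R :> k -> m = n.
Proof.
wlog le : m n / (m <= n)%N => [H|e].
  by case/orP: (leq_total m n) => le e; [|apply/esym]; apply: H.
apply/eqP; rewrite eqn_leq le -subn_eq0 -(natr_eq0_char0 char0) natrB // e.
by rewrite subrr eqxx.
Qed.

(** Acting by the torus multiplies the constant term of the coordinate at [T] by
    the weight of [generator T], which is recovered from the torus elements
    (2, 1) and (1, 2) because powers of 2 are distinct in characteristic
    zero. *)
Lemma tor_weight_coef0 i a phi (b : SYT d la -> S) T :
    (a <= d * i)%N -> tor_weight i a (d * i - a) phi ->
    (forall T, B_ring (b T)) -> phi = \sum_T b T *: generator T ->
  T \notin tor_index i a -> (b T)@_0%MM = 0.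
Proof.
move=> le_a [_ wt] Bb ephi nT; apply/eqP/negPn/negP => ne0; case/negP: nT.
have chi (t : 'rV[k]_2) : (forall j, t 0 j != 0) ->
    t 0 0 ^+ maj T * t 0 1 ^+ (d * des T - maj T) = t 0 0 ^+ a * t 0 1 ^+ (d * i - a).
  move=> t0; pose x T' := t 0 0 ^+ maj T' * t 0 1 ^+ (d * des T' - maj T').
  pose y := t 0 0 ^+ a * t 0 1 ^+ (d * i - a).
  pose c T' : S := x T' *: gl_act (diag_mx t) (b T') - y *: b T'.
  have Bc T' : B_ring (c T').
    rewrite /c -scaleNr; apply: B_ringD => //; apply: B_ringZ => //.
    exact: B_ring_gl_act_diag.
  have ec : map_mx (gl_act (diag_mx t)) phi - y%:MP *: phi = \sum_T' c T' *: generator T'.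
    rewrite ephi scaler_sumr; under [RHS]eq_bigr do rewrite scalerBl.
    rewrite sumrB; congr (_ - _); last first.
      by apply: eq_bigr => T' _; rewrite scalerA mul_mpolyC.
    apply/colP => u; rewrite mxE !summxE gl_act_sum; apply: eq_bigr => T' _.
    rewrite mxE gl_actM; have /colP/(_ u) := gl_act_generator t T'.
    by rewrite mxE => ->; rewrite !mxE mulrCA mulrA mul_mpolyC.
  have := wt t t0; rewrite -/y ec => /(BplusM_coef0 Bc)/(_ T).
  rewrite /c mcoeffB !mcoeffZ gl_act_const -mulrBl => /eqP.
  by rewrite mulf_eq0 (negbTE ne0) orbF subr_eq0 => /eqP.
have two0 : 2%:R != 0 :> k by rewrite natr_eq0_char0.
have pow2 m n : (2%:R : k) ^+ m = 2%:R ^+ n -> m = n.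
  by rewrite -!natrX => /natr_inj_char0/eqP; rewrite eqn_exp2l // => /eqP.
have e1 : maj T = a.
  have := chi (\row_j if j == 0 then 2%:R else 1).
  rewrite !mxE /= !expr1n !mulr1 => /(_ _)/pow2; apply=> j.
  by rewrite mxE; case: ifP; rewrite ?oner_eq0.
have e2 : (d * des T - maj T = d * i - a)%N.
  have := chi (\row_j if j == 0 then 1 else 2%:R).
  rewrite !mxE /= !expr1n !mul1r => /(_ _)/pow2; apply=> j.
  by rewrite mxE; case: ifP; rewrite ?oner_eq0.
rewrite inE /= e1 eqxx andbT -(eqn_pmul2l d_gt0); apply/eqP.
by have := maj_le T; move: e1 e2 le_a; lia.
Qed.

Lemma tor_dim i a : (a <= d * i)%N ->
  tor_subspace_dim (@tor_weight k d la i a (d * i - a)) #|tor_index i a|.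
Proof.
move=> le_a; exists (fun x => generator (enum_val x)); split=> [x|v Wv|c].
- move: (enum_val x) (enum_valP x) => T /andP[/eqP ei /eqP ea]; split.
    by rewrite -ei; apply: gen_deg.
  move=> t _; rewrite gl_act_generator -ei -ea subrr.
  by exists 0%N, (fun=> 0), (fun=> 0); split=> [[]|] //; rewrite big_ord0.
- have [eqv [b [Bb eb]]] := (Wv.1, gen_span (M_deg_mod Wv.1)).
  exists (fun x => (b (enum_val x))@_0%MM).
  have -> : v - \sum_(x < #|tor_index i a|)
        ((b (enum_val x))@_0%MM)%:MP *: generator (enum_val x) =
      \sum_T (b T - ((b T)@_0%MM)%:MP) *: generator T.
    rewrite {1}eb; under [RHS]eq_bigr do rewrite scalerBl.
    rewrite sumrB; congr (_ - _).
    rewrite -(big_enum_val (fun T => ((b T)@_0%MM)%:MP *: generator T)) big_mkcond /=.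
    apply: eq_bigr => T _; case: ifPn => // nT.
    by rewrite (tor_weight_coef0 le_a Wv Bb eb nT) mpolyC0 scale0r.
  apply: BplusM_sum => T; split; last by rewrite mcoeffB mcoeffC eqxx mulr1 subrr.
  by rewrite -mpolyCN; apply: B_ringD => //; apply: B_ringC.
move=> h x; pose b T : S := (\sum_(y | enum_val y == T) c y)%:MP.
have eb : \sum_y (c y)%:MP *: generator (enum_val y) = \sum_T b T *: generator T.
  rewrite (partition_big (fun y => enum_val y) xpredT) //=; apply: eq_bigr => T _.
  rewrite /b raddf_sum scaler_suml; apply: eq_bigr => y /eqP <- //.
rewrite eb in h; have := BplusM_coef0 (fun T => B_ringC d_gt0 _) h (enum_val x).
rewrite mcoeffC eqxx mulr1 (big_pred1 x) => [//|y].
by rewrite (inj_eq enum_val_inj).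
Qed.

Lemma tor_char i : is_tor_char k d la i (\sum_(T : SYT d la | des T == i) 'X^(maj T)).
Proof.
exists (fun a => #|tor_index i a|); split=> [a|]; first exact: tor_dim.
apply/polyP => a; rewrite coef_poly coef_sum.
have -> : \sum_(T : SYT d la | des T == i) ('X^(maj T))`_a = #|tor_index i a|%:R :> int.
  rewrite -sum1_card natr_sum [RHS]big_mkcond [LHS]big_mkcond /=.
  apply: eq_bigr => T _; rewrite coefXn inE /= [a == _]eq_sym.
  by case: (des T == i); case: (maj T == a).
rewrite ltnS; case: leqP => // lt; rewrite eq_card0 // => T; rewrite !inE.
apply/negP => /andP[/eqP ei /eqP ea].
by have := maj_le T; rewrite ea ei leqNgt lt.
Qed.

End Generators.

Theorem corollary3p15 (k : closedFieldType) (char0 : [pchar k] =i pred0)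
    (d : nat) (d_gt0 : (0 < d)%N) (la : seq nat) (la_d : is_partition d la) :
  (exists g : SYT d la -> covector k d la,
     (forall T : SYT d la, M_deg (des T) (g T)) /\ minimal_generators g) /\
  (forall i : nat,
     is_tor_char k d la i (\sum_(T : SYT d la | des T == i) 'X^(maj T))).
Proof.
split=> [|i]; last exact: tor_char.
by exists (@generator k d la); split=> [T|]; [apply: gen_deg | apply: gen_minimal].
Qed.
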